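(* Let $p$ be a prime, let $\mathcal{F}$ be a fusion system over a finite $p$-group $S$, and let $\mathcal{H}$ be a set of subgroups of $S$ closed under $\mathcal{F}$-conjugacy that contains all subgroups of $S$ which are both $\mathcal{F}$-centric and $\mathcal{F}$-radical. Assume that $\mathcal{F}$ is $\mathcal{H}$-generated and $\mathcal{H}$-saturated, and that each $\mathcal{F}$-conjugacy class of subgroups of $S$ which are $\mathcal{F}$-centric but not in $\mathcal{H}$ contains at least one subgroup $P$ such that $\mathrm{Out}_S(P)\cap O_p(\mathrm{Out}_{\mathcal{F}}(P))\ne 1$. Then $\mathcal{F}$ is saturated.
   Context: For subgroups $P,Q$ of a finite $p$-group $S$: $c_x$ denotes conjugation $g\mapsto xgx^{-1}$; $\mathrm{Hom}_S(P,Q)$ is the set of homomorphisms $P\to Q$ induced by conjugation by elements of $S$; $\mathrm{Aut}_S(P)=\mathrm{Hom}_S(P,P)$, $\mathrm{Out}_S(P)=\mathrm{Aut}_S(P)/\mathrm{Inn}(P)$; $\mathrm{Inj}(P,Q)$ is the set of injective homomorphisms. $O_p(G)$ is the maximal normal $p$-subgroup of $G$. A fusion system $\mathcal{F}$ over $S$ is a category whose objects are all subgroups of $S$, whose morphisms are group homomorphisms, such that for all $P,Q\le S$: $\mathrm{Hom}_S(P,Q)\subseteq \mathrm{Hom}_{\mathcal{F}}(P,Q)\subseteq \mathrm{Inj}(P,Q)$, and each $\varphi\in\mathrm{Hom}_{\mathcal{F}}(P,Q)$ is the composite of an isomorphism in $\mathcal{F}$ followed by an inclusion. $\mathrm{Aut}_{\mathcal{F}}(P)=\mathrm{Hom}_{\mathcal{F}}(P,P)$,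 $\mathrm{Out}_{\mathcal{F}}(P)=\mathrm{Aut}_{\mathcal{F}}(P)/\mathrm{Inn}(P)$. Subgroups are $\mathcal{F}$-conjugate if isomorphic in $\mathcal{F}$. $P\le S$ is $\mathcal{F}$-centric if $C_S(P')=Z(P')$ for all $P'$ $\mathcal{F}$-conjugate to $P$; $\mathcal{F}$-radical if $O_p(\mathrm{Out}_{\mathcal{F}}(P))=1$; fully centralized (resp. fully normalized) in $\mathcal{F}$ if $|C_S(P)|\ge|C_S(P')|$ (resp. $|N_S(P)|\ge|N_S(P')|$) for all $P'$ $\mathcal{F}$-conjugate to $P$. Axioms of saturation for a subgroup $P\le S$: (I) If $P$ is fully normalized in $\mathcal{F}$, then $P$ is fully centralized in $\mathcal{F}$ and $\mathrm{Aut}_S(P)\in\mathrm{Syl}_p(\mathrm{Aut}_{\mathcal{F}}(P))$. (II) If $\varphi\in\mathrm{Hom}_{\mathcal{F}}(P,S)$ is such that $\varphi(P)$ is fully centralized, and $N_\varphi=\{g\in N_S(P)\mid \varphi c_g\varphi^{-1}\in\mathrm{Aut}_S(\varphi(P))\}$, then there is $\overline{\varphi}\in\mathrm{Hom}_{\mathcal{F}}(N_\varphi,S)$ with $\overline{\varphi}|_P=\varphi$. $\mathcal{F}$ is saturated if (I) and (II) hold for all $P\le S$. For a set $\mathcal{H}$ of subgroups of $S$ closed under $\mathcal{F}$-conjugacy: $\mathcal{F}$ is $\mathcal{H}$-generated if every morphism in $\mathcal{F}$ is a composite of restrictions of morphisms in $\mathcal{F}$ between subgroups in $\mathcal{H}$;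 $\mathcal{F}$ is $\mathcal{H}$-saturated if (I) and (II) hold in $\mathcal{F}$ for all $P\in\mathcal{H}$. *)

(* Defs.v *)
From mathcomp Require Import all_boot all_fingroup all_solvable.

Set Implicit Arguments.
Unset Strict Implicit.
Unset Printing Implicit Defensive.

Import GroupScope.

Section Homomorphisms.

Variable gT : finGroupType.
Implicit Types (S P Q : {group gT}) (f : gT -> gT).

(* A homomorphism from P is represented by a function gT -> gT of which only  *)
(* the values on P matter.                                                    *)

(* cmap x g = x * g * x^-1, whereas g ^ x = x^-1 * g * x.                     *)
Definition cmap (x g : gT) : gT := g ^ x^-1.

Definition Inj P Q f : Prop :=
  [/\ {in P &, {morph f : x y / x * y}}, {in P &, injective f}
    & {in P, forall x, f x \in Q}].

Definition HomS S P Q : pred (gT -> gT) := fun f =>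
  [exists x in S, forall g in P, (f g == cmap x g) && (cmap x g \in Q)].

(* An automorphism of P is the permutation in Aut P that extends it by the    *)
(* identity outside P. Since (a * b) x = b (a x) in {perm gT}, the groups     *)
(* below are the opposites of the usual ones, hence isomorphic to them.       *)
Definition AutS S P : {set {perm gT}} := [set a in Aut P | HomS S P P a].

Definition Inn P : {group {perm gT}} := (conj_aut P @* P)%G.

Definition OutS S P : {set coset_of (Inn P)} := AutS S P / Inn P.

Lemma AutS_Inn P : AutS P P = Inn P.
Proof.
apply/setP=> a; rewrite inE.
apply/andP/morphimP=> [[Aa /exists_inP[x Px /forall_inP hx]]|[x Nx Px ->]].
  have Nx : x^-1 \in 'N(P) by rewrite (subsetP (normG P)) ?groupV.
  have Ac : conj_aut P x^-1 \in Aut P.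
    by apply: (subsetP (Aut_conj_aut P P)); rewrite mem_morphim // groupV.
  exists x^-1; [exact: Nx | by rewrite groupV | apply: (eq_Aut Aa Ac) => u Pu].
  by have /andP[/eqP-> _] := hx u Pu; rewrite conj_autE ?groupV.
split.
  by apply: (subsetP (Aut_conj_aut P P)); exact: mem_morphim.
apply/exists_inP; exists x^-1; rewrite ?groupV //; apply/forall_inP=> u Pu.
by rewrite /cmap invgK conj_autE // eqxx groupJ.
Qed.

Lemma AutS_group_set S P : group_set (AutS S P).
Proof.
apply/group_setP; split=> [|a b].
  rewrite inE group1; apply/exists_inP; exists 1; rewrite ?group1 //.
  by apply/forall_inP=> g Pg; rewrite perm1 /cmap invg1 conjg1 eqxx.
rewrite [a \in _]inE [b \in _]inE.
case/andP=> Aa /exists_inP[x Sx /forall_inP hx].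
case/andP=> Ab /exists_inP[y Sy /forall_inP hy].
rewrite inE groupM //; apply/exists_inP; exists (y * x); rewrite ?groupM //.
apply/forall_inP=> g /hx/andP[/eqP ag Pxg].
have /andP[/eqP bg Pyg] := hy _ Pxg.
have ->: cmap (y * x) g = cmap y (cmap x g) by rewrite /cmap invMg conjgM.
by rewrite permM ag bg Pyg eqxx.
Qed.
Canonical AutS_group S P := Group (AutS_group_set S P).

(* The condition phi c_g phi^-1 = a on phi(P) is written a phi = phi c_g.     *)
Definition Nphi S P (phi : {morphism P >-> gT}) : {set gT} :=
  [set g in 'N_S(P) | [exists a in AutS S (phi @* P),
     forall u in P, a (phi u) == phi (cmap g u)]].

Lemma Nphi_group_set S P (phi : {morphism P >-> gT}) :
  group_set (Nphi S phi).
Proof.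
apply/group_setP; split=> [|g h].
  rewrite inE group1; apply/exists_inP; exists 1; rewrite ?group1 //.
  by apply/forall_inP=> u Pu; rewrite perm1 /cmap invg1 conjg1.
rewrite [g \in _]inE [h \in _]inE.
case/andP=> Ng /exists_inP[a Aa /forall_inP ha].
case/andP=> Nh /exists_inP[b Ab /forall_inP hb].
rewrite inE groupM //; apply/exists_inP; exists (b * a); rewrite ?groupM //.
apply/forall_inP=> u Pu; rewrite permM (eqP (hb u Pu)).
have Phu : cmap h u \in P.
  by rewrite /cmap memJ_norm // groupV; case/setIP: Nh.
by rewrite (eqP (ha _ Phu)) /cmap invMg conjgM.
Qed.
Canonical Nphi_group S P (phi : {morphism P >-> gT}) :=
  Group (Nphi_group_set S phi).

End Homomorphisms.

(* The objects are the P with P \subset S: the sets fs_hom P Q are empty for  *)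
(* all other P or Q.                                                          *)
Record fusion_system (gT : finGroupType) (S : {group gT}) := FusionSystem {
  fs_hom :> {group gT} -> {group gT} -> pred (gT -> gT);
  fs_obj : forall P Q f, fs_hom P Q f -> P \subset S /\ Q \subset S;
  fs_ext : forall (P Q : {group gT}) f g, {in P, f =1 g} -> fs_hom P Q f -> fs_hom P Q g;
  fs_id : forall P : {group gT}, P \subset S -> fs_hom P P id;
  fs_comp : forall P Q R f g,
    fs_hom P Q f -> fs_hom Q R g -> fs_hom P R (g \o f);
  fs_HomS : forall (P Q : {group gT}) f, P \subset S -> Q \subset S ->
    HomS S P Q f -> fs_hom P Q f;
  fs_Inj : forall P Q f, fs_hom P Q f -> Inj P Q f;
  fs_factor : forall P Q f, fs_hom P Q f ->
    exists R : {group gT}, R \subset Q /\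
    exists h, [/\ fs_hom P R h,
      (exists k, [/\ fs_hom R P k, {in P, cancel h k} & {in R, cancel k h}])
      & {in P, f =1 h}]
}.

Section FusionSystem.

Variables (p : nat) (gT : finGroupType) (S : {group gT}).
Variable F : fusion_system S.
Implicit Types (P Q R : {group gT}) (H : {set {group gT}}).

Definition fs_iso P Q (f : gT -> gT) : Prop :=
  F P Q f /\ exists k, [/\ F Q P k, {in P, cancel f k} & {in Q, cancel k f}].

Definition fs_conj P Q : Prop := exists f, fs_iso P Q f.

Definition AutF P : {set {perm gT}} := [set a in Aut P | F P P a].

Lemma AutF_group_set P : P \subset S -> group_set (AutF P).
Proof.
move=> sPS; apply/group_setP; split=> [|a b].
  rewrite inE group1; apply: fs_ext (fs_id F sPS) => x _; exact/esym/perm1.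
rewrite [a \in _]inE [b \in _]inE => /andP[Aa Fa] /andP[Ab Fb].
rewrite inE groupM //; apply: fs_ext (fs_comp Fa Fb) => x _ /=.
by rewrite permM.
Qed.

Lemma AutF_repr P f : F P P f -> exists2 a, a \in AutF P & {in P, a =1 f}.
Proof.
move=> Ff; have [fM fI fP] := fs_Inj Ff.
pose m := Morphism fM; have mI : 'injm m by apply/injmP.
have mP : m @* P = P.
  apply/eqP; rewrite eqEcard card_injm // leqnn andbT.
  by apply/subsetP=> _ /morphimP[x Px _ ->]; exact: fP.
exists (aut mI mP); last by move=> x Px; rewrite autE.
by rewrite inE Aut_aut; apply: fs_ext Ff => x Px; rewrite autE.
Qed.

Definition OutF P : {set coset_of (Inn P)} := AutF P / Inn P.

Definition centric P : Prop := forall P', fs_conj P P' -> 'C_S(P') = 'Z(P').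

Definition radical P : Prop := 'O_p(OutF P) = 1.

Definition fully_centralized P : Prop :=
  forall P', fs_conj P P' -> #|'C_S(P')| <= #|'C_S(P)|.

Definition fully_normalized P : Prop :=
  forall P', fs_conj P P' -> #|'N_S(P')| <= #|'N_S(P)|.

Definition saturation_I P : Prop :=
  fully_normalized P -> fully_centralized P /\ p.-Sylow(AutF P) (AutS S P).

Definition saturation_II P : Prop :=
  forall phi : {morphism P >-> gT}, F P S phi ->
  fully_centralized (phi @* P)%G ->
  exists psi : {morphism Nphi S phi >-> gT},
    F (Nphi_group S phi) S psi /\ {in P, psi =1 phi}.

Definition saturated : Prop :=
  forall P, P \subset S -> saturation_I P /\ saturation_II P.

Definition conj_closed H : Prop :=
  forall P Q, P \in H -> fs_conj P Q -> Q \in H.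

Inductive generated_by H : {group gT} -> {group gT} -> (gT -> gT) -> Prop :=
| gen_restr P Q P1 Q1 f g of P1 \in H & Q1 \in H & F P1 Q1 g
    & P \subset P1 & Q \subset Q1 & {in P, forall x, g x \in Q}
    & {in P, f =1 g} : generated_by H P Q f
| gen_comp P Q R f g h of generated_by H P Q f & generated_by H Q R g
    & {in P, h =1 g \o f} : generated_by H P R h.

Definition H_generated H : Prop :=
  forall P Q f, F P Q f -> generated_by H P Q f.

Definition H_saturated H : Prop :=
  forall P, P \in H -> saturation_I P /\ saturation_II P.

End FusionSystem.

(* Main.v *)
Require Import Defs.
From mathcomp Require Import all_boot all_fingroup all_solvable.
From Stdlib Require Import Classical.

(** The saturation axioms are proved for all [P] by descending induction on [|P|]; let
    [P] lie outside [H], and suppose that they hold for all larger subgroups.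

    In the normalizer of [P], replace full normalization by its relative version: every
    [Q > P] has an image [(Q', P')] such that [Q'] is fully centralized and the image of
    [N_S(P')] is a Sylow subgroup of the stabilizer of [P'] in [Aut_F(Q')]. Extension
    (axiom II for [Q]) then lets one enlarge the domain of any morphism that is defined
    on an overgroup of [P]. As [F] is [H]-generated, every morphism on [P] is a composite
    of such restrictions; a descending induction on the domain and Newman's argument for
    confluence give a member [T] of the class of [P] such that each [N_S(R)], [R] in the
    class, maps to [N_S(T)] with [R] going to [T].

    Let [M] be the group of those [g] in [N_S(T)] for which [c_g] is in [O_p(Aut_F(T))].
    It is larger than [T]: if [P] is not centric because of [C_S(R) > Z(R)], otherwise
    because of the hypothesis on [Out_S(P')]. A normal [p]-subgroup of the stabilizer's
    image in [Aut_F(T)] lies in the image of the Sylow subgroup, so that the enlargement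
    never has to leave the given automorphism of [T], and every element of [Aut_F(T)]
    extends to [M]. The axioms for [T], and from there for its class, follow from those
    for [M]. *)

Set Implicit Arguments.
Unset Strict Implicit.
Unset Printing Implicit Defensive.

Import GroupScope.

(** * Images of subgroups, and automizers *)

Section Image.

Variable gT : finGroupType.
Implicit Types (P Q W : {group gT}) (f : gT -> gT).

(* Equal to [f @: P] when [f] is a homomorphism on [P]; generating makes it a group. *)
Definition im f P : {group gT} := [group of <<f @: P>>].

Lemma mem_im f P x : x \in P -> f x \in im f P.
Proof. by move=> Px; rewrite mem_gen // imset_f. Qed.

Lemma eq_im f g P : {in P, f =1 g} -> im f P = im g P.
Proof. by move=> fg; apply: val_inj; rewrite /= (eq_in_imset fg). Qed.

Lemma im_id P : im id P = P.
Proof. by apply: val_inj; rewrite /= imset_id genGid. Qed.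

Lemma Inj_im P Q f : Inj P Q f -> im f P = f @: P :> {set gT}.
Proof.
case=> fM _ _; rewrite /= -(morphimEdom (Morphism fM)).
by rewrite genGid.
Qed.

(** Trading [x] for its inverse passes from the left conjugation [cmap] to the right conjugation
    [u ^ h], in which [conj_aut] is expressed. *)
Lemma AutS_memP W P (a : {perm gT}) :
  reflect (a \in Aut P /\ exists2 h, h \in W & {in P, forall u, a u = u ^ h})
          (a \in AutS W P).
Proof.
rewrite [X in reflect _ X]inE; apply: (iffP andP) => -[Aa].
  case/exists_inP=> x Wx /forall_inP hx; split=> //; exists x^-1.
    by rewrite groupV.
  by move=> u Pu; have /andP[/eqP-> _] := hx u Pu.
case=> h Wh ah; split=> //; apply/exists_inP; exists h^-1; rewrite ?groupV //.
apply/forall_inP=> u Pu; rewrite /cmap invgK -ah // eqxx.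
exact: Aut_closed.
Qed.

Lemma conj_aut_Aut P h : h \in 'N(P) -> conj_aut P h \in Aut P.
Proof.
by move=> Nh; apply: (subsetP (Aut_conj_aut P 'N(P))); rewrite mem_morphim.
Qed.

Lemma AutSE W P : AutS W P = conj_aut P @* 'N_W(P).
Proof.
apply/setP=> a; apply/AutS_memP/morphimP.
  case=> Aa [h Wh ah]; have Nh : h \in 'N(P).
    apply/normP/eqP; rewrite eqEcard cardJg leqnn andbT.
    apply/subsetP=> _ /imsetP[u Pu ->]; rewrite -ah //; exact: Aut_closed.
  exists h => //; first by rewrite inE Wh.
  apply: (eq_Aut Aa (conj_aut_Aut Nh)) => u Pu; by rewrite (ah _ Pu) norm_conj_autE.
case=> h Nh /setIP[Wh _] ->; split; first exact: conj_aut_Aut.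
by exists h => // u Pu; rewrite norm_conj_autE.
Qed.

End Image.

(** * Elementary calculus of morphisms in a fusion system *)

Section Homs.

Variables (gT : finGroupType) (S : {group gT}) (F : fusion_system S).
Implicit Types (P Q R V W : {group gT}) (f g : gT -> gT).

Lemma hom_src P Q f : F P Q f -> P \subset S.
Proof. by case/fs_obj. Qed.

Lemma homM P Q f : F P Q f -> {in P &, {morph f : x y / x * y}}.
Proof. by case/fs_Inj. Qed.

Lemma hom_inj P Q f : F P Q f -> {in P &, injective f}.
Proof. by case/fs_Inj. Qed.

Lemma hom_mem P Q f x : F P Q f -> x \in P -> f x \in Q.
Proof. by case/fs_Inj=> _ _; apply. Qed.

Lemma homJ P Q f : F P Q f -> {in P &, {morph f : x y / x ^ y}}.
Proof.
move=> /homM fM x y Px Py; have:= @morphJ _ _ P (Morphism fM) x y Px Py.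
by [].
Qed.

Lemma hom_im P Q f : F P Q f -> im f P = f @: P :> {set gT}.
Proof. by case/fs_Inj=> fM fI fQ; apply: (@Inj_im _ P Q). Qed.

Lemma hom_im_sub P Q f : F P Q f -> im f P \subset Q.
Proof.
move=> Ff; rewrite (hom_im Ff); apply/subsetP=> _ /imsetP[x Px ->].
exact: hom_mem Px.
Qed.

Lemma card_im P Q f : F P Q f -> #|im f P| = #|P|.
Proof. by move=> Ff; rewrite (hom_im Ff) card_in_imset //; apply: hom_inj Ff. Qed.

Lemma hom_incl P Q : P \subset Q -> Q \subset S -> F P Q id.
Proof.
move=> sPQ sQS; apply: fs_HomS => //; first exact: subset_trans sQS.
apply/exists_inP; exists 1; rewrite ?group1 //; apply/forall_inP=> x Px.
by rewrite /cmap invg1 conjg1 eqxx (subsetP sPQ).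
Qed.

Lemma hom_sub P Q f P0 : F P Q f -> P0 \subset P -> F P0 Q f.
Proof. by move=> Ff sP; apply: (fs_comp (hom_incl sP (hom_src Ff)) Ff). Qed.

Lemma im_sub P Q f P0 : F P Q f -> P0 \subset P -> im f P0 = f @: P0 :> {set gT}.
Proof. by move=> Ff /(hom_sub Ff)/hom_im. Qed.

(** The subgroup [R] of [fs_factor] is forced to be the image: it contains every value of [f], and
    the inverse of [h] shows that it is no larger. So every morphism is an isomorphism onto
    [im f P]. *)
Lemma hom_factor P Q f : F P Q f ->
  F P (im f P) f /\ exists k, [/\ F (im f P) P k, {in P, cancel f k}
                              & {in im f P, cancel k f}].
Proof.
move=> Ff; have [R [_ [h [Fh [k [Fk hk kh]] fh]]]] := fs_factor Ff.
have eR : im f P = R.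
  apply: val_inj; apply/eqP; rewrite eqEsubset; apply/andP; split.
    rewrite /= gen_subG; apply/subsetP=> _ /imsetP[x Px ->]; rewrite fh //.
    exact: hom_mem Px.
  apply/subsetP=> y Ry; rewrite -(kh _ Ry) -fh ?mem_im //; exact: hom_mem Ry.
rewrite eR; split; first by apply: fs_ext Fh => x Px; rewrite fh.
exists k; split=> // x Hx; first by rewrite fh ?hk.
by rewrite fh ?kh //; apply: hom_mem Hx.
Qed.

Lemma hom_tgt P Q f R : F P Q f -> R \subset S -> {in P, forall x, f x \in R} ->
  F P R f.
Proof.
move=> Ff sRS fR; have [Fim _] := hom_factor Ff.
apply: (fs_comp Fim (hom_incl _ sRS)); rewrite gen_subG.
by apply/subsetP=> _ /imsetP[x Px ->]; apply: fR.
Qed.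

Lemma homS P Q f : F P Q f -> F P S f.
Proof.
move=> Ff; have [_ sQS] := fs_obj Ff; apply: (hom_tgt Ff) => // x Px.
exact: (subsetP sQS) (hom_mem Ff Px).
Qed.

Lemma hom_compim P Q R f g : F P Q f -> F (im f P) R g -> F P R (g \o f).
Proof. by case/hom_factor=> Ff _; apply: fs_comp Ff. Qed.

Lemma im_comp P Q f g W : F P Q f -> W \subset P -> im (g \o f) W = im g (im f W).
Proof.
by move=> Ff sWP; apply: group_inj; rewrite /= (im_sub Ff sWP) -imset_comp.
Qed.

Lemma homJx P x : P \subset S -> x \in S -> F P S (conjg^~ x).
Proof.
move=> sPS Sx; apply: fs_HomS => //; apply/exists_inP; exists x^-1.
  by rewrite groupV.
apply/forall_inP=> u Pu; rewrite /cmap invgK eqxx groupJ //.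
exact: (subsetP sPS).
Qed.

Lemma im_norm P Q f W : F P Q f -> W \subset P -> P \subset 'N(W) ->
  im f P \subset 'N(im f W).
Proof.
move=> Ff sWP nWP; rewrite (hom_im Ff); apply/subsetP=> _ /imsetP[x Px ->].
rewrite inE (im_sub Ff sWP); apply/subsetP=> _ /imsetP[_ /imsetP[y Wy ->] ->].
have Py := subsetP sWP y Wy; rewrite -(homJ Ff) // imset_f // memJ_norm //.
exact: (subsetP nWP).
Qed.

Lemma imS P Q f W V : F P Q f -> W \subset V -> V \subset P -> im f W \subset im f V.
Proof.
by move=> Ff sWV sVP; rewrite (im_sub Ff (subset_trans sWV sVP)) (im_sub Ff sVP) imsetS.
Qed.

Lemma conjP P Q : fs_conj F P Q <-> exists2 f, F P S f & im f P = Q.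
Proof.
split=> [[f [Ff [k [Fk fk kf]]]]|[f Ff <-]].
  exists f; first exact: homS Ff.
  apply: val_inj; apply/eqP; rewrite eqEsubset (hom_im_sub Ff).
  apply/subsetP=> y Qy; rewrite -(kf y Qy) mem_im //; exact: hom_mem Qy.
by have [Ff' k] := hom_factor Ff; exists f; split.
Qed.

Lemma conj_refl P : P \subset S -> fs_conj F P P.
Proof.
by move=> sPS; apply/conjP; exists id; rewrite ?im_id //; apply: hom_incl.
Qed.

Lemma conj_sym P Q : fs_conj F P Q -> fs_conj F Q P.
Proof. by case=> f [Ff [k [Fk fk kf]]]; exists k; split=> //; exists f. Qed.

Lemma conj_trans P Q R : fs_conj F P Q -> fs_conj F Q R -> fs_conj F P R.
Proof.
case/conjP=> f Ff <- /conjP[g Fg <-]; apply/conjP; exists (g \o f).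
  exact: hom_compim Ff Fg.
exact: im_comp Ff (subxx P).
Qed.

Lemma conj_sub P Q : fs_conj F P Q -> P \subset S /\ Q \subset S.
Proof. by case=> f [Ff _]; apply: fs_obj Ff. Qed.

Lemma conj_card P Q : fs_conj F P Q -> #|P| = #|Q|.
Proof. by case/conjP=> f Ff <-; rewrite (card_im Ff). Qed.

Lemma exists_fully_normalized P : P \subset S ->
  exists2 Q, fs_conj F P Q & fully_normalized F Q.
Proof.
move=> sPS; have [m lem] := ubnP (#|S| - #|'N_S(P)|).
elim: m P sPS lem => // m IHm P sPS lem.
have [nP|nP] := classic (fully_normalized F P).
  by exists P => //; apply: conj_refl.
have [Q nQ] := not_all_ex_not _ _ nP.
have [cPQ /negP] := imply_to_and _ _ nQ; rewrite -ltnNge => ltN.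
have [_ sQS] := conj_sub cPQ.
have leS : #|'N_S(Q)| <= #|S| by rewrite subset_leq_card // subsetIl.
have [|R cQR nR] := IHm Q sQS; last by exists R => //; apply: conj_trans cQR.
by rewrite -ltnS (leq_trans _ lem) // ltnS ltn_sub2l // (leq_trans ltN).
Qed.

(** The form in which axiom II is used: membership in [Nphi] is tested on elements, by right
    conjugation, and the domain may be any group [W] that passes the test. *)
Lemma ext_II Q f W : saturation_II F Q -> F Q S f -> fully_centralized F (im f Q) ->
  W \subset 'N_S(Q) ->
  {in W, forall x, exists2 y, y \in S & {in Q, forall u, f (u ^ x) = f u ^ y}} ->
  exists2 g, F W S g & {in Q, g =1 f}.
Proof.
move=> satQ Ff cQ sWN hW; have fM := homM Ff.
have eim : (Morphism fM @* Q)%G = im f Q.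
  by apply: group_inj; rewrite (hom_im Ff); apply: morphimEdom.
have [||psi [Fpsi epsi]] := satQ (Morphism fM); rewrite ?eim //.
exists psi => //; apply: hom_sub Fpsi _; apply/subsetP=> g Wg.
have Ng := subsetP sWN g Wg; rewrite inE Ng /=.
(* [Nphi] conjugates by [cmap g], which is right conjugation by [g^-1]. *)
have [h Sh hf] := hW g^-1 (groupVr Wg).
have nQg : g^-1 \in 'N(Q) by rewrite groupV; case/setIP: Ng.
have Nh : h \in 'N(im f Q).
  apply/normP/eqP; rewrite eqEcard cardJg leqnn andbT.
  rewrite {1}(hom_im Ff); apply/subsetP=> _ /imsetP[_ /imsetP[u Qu ->] ->].
  by rewrite -hf // mem_im // memJ_norm.
apply/exists_inP; exists (conj_aut (im f Q) h).
  by rewrite eim AutSE mem_morphim // inE Sh.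
apply/forall_inP=> u Qu; rewrite norm_conj_autE ?mem_im //=.
by rewrite /cmap hf.
Qed.

End Homs.

(** * The groups [Aut_F(P)] and [O_p(Aut_F(P))], and the preimage of the latter in [N_S(P)] *)

Section AutomorphismGroups.

Variables (p : nat) (gT : finGroupType) (S : {group gT}) (F : fusion_system S).
Hypothesis pS : p.-group S.
Implicit Types (P Q R V W : {group gT}) (f : gT -> gT) (a b : {perm gT}) (g : gT).

(* [AutF F P] is a group only for [P \subset S]. *)
Definition AutFG P : {group {perm gT}} := [group of <<AutF F P>>].

Lemma AutFGE P : P \subset S -> AutFG P = AutF F P :> {set {perm gT}}.
Proof. by move=> sPS; apply: (genGid (Group (AutF_group_set F sPS))). Qed.

Lemma AutFGP P a : P \subset S -> reflect (a \in Aut P /\ F P P a) (a \in AutFG P).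
Proof. by move=> sPS; rewrite AutFGE // [X in reflect _ X]inE; apply: andP. Qed.

Lemma AutFG_sub_Aut P : P \subset S -> AutFG P \subset Aut P.
Proof. by move=> sPS; apply/subsetP=> a /(AutFGP _ sPS)[]. Qed.

Lemma AutF_ext P f : F P P f -> exists2 a, a \in AutFG P & {in P, a =1 f}.
Proof.
move=> Ff; have [a Aa af] := AutF_repr Ff.
by exists a; rewrite ?AutFGE // (hom_src Ff).
Qed.

Lemma AutS_p P W : p.-group W -> p.-group (AutS W P).
Proof.
by move=> pW; rewrite AutSE morphim_pgroup // (pgroupS (subsetIl _ _)).
Qed.

Lemma AutS_sub_AutFG P : P \subset S -> AutS S P \subset AutFG P.
Proof.
move=> sPS; apply/subsetP=> a /AutS_memP[Aa [h Sh ah]]; apply/AutFGP => //.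
split=> //; apply: (@fs_ext _ _ F P P (conjg^~ h)) => [u Pu|]; first by rewrite ah.
apply: (hom_tgt (homJx F sPS Sh) sPS) => u Pu; rewrite -ah //.
exact: Aut_closed.
Qed.

Lemma AutS_sub V W P : V \subset W -> AutS V P \subset AutS W P.
Proof.
move=> sVW; apply/subsetP=> a /AutS_memP[Aa [h Sh ah]]; apply/AutS_memP.
by split=> //; exists h => //; apply: (subsetP sVW).
Qed.

(** Conjugation by [f]. It carries [Aut_F(P)] onto [Aut_F(im f P)] because both [f] and its inverse
    on the image are morphisms of [F]. *)
Lemma transport P f : F P S f ->
  exists t : {morphism Aut P >-> {perm gT}},
  [/\ 'injm t, t @* Aut P = Aut (im f P), t @* AutFG P = AutFG (im f P)
    & {in Aut P & P, forall a u, t a (f u) = f (a u)}].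
Proof.
move=> Ff; pose m := Morphism (homM Ff).
have mI : 'injm m by apply/injmP; apply: hom_inj Ff.
have eim : m @* P = im f P by rewrite (hom_im Ff); apply: morphimEdom.
pose t := Aut_isom_morphism mI (subxx P).
have tI : 'injm t by apply: injm_Aut_isom.
have tA : t @* Aut P = Aut (im f P) by rewrite -eim; apply: im_Aut_isom.
have tE : {in Aut P & P, forall a u, t a (f u) = f (a u)}.
  by move=> a u Aa Pu; apply: (Aut_isomE mI (subxx P) Aa Pu).
have sPS := hom_src Ff; have sQS := hom_im_sub Ff.
have [Ff' [k [Fk fk kf]]] := hom_factor Ff.
exists t; split=> //; apply/setP=> a'; apply/morphimP/AutFGP => //.
  case=> a Aa /AutFGP[]// _ Fa ->; split; first by rewrite -tA mem_morphim.
  apply: (fs_ext _ (fs_comp (fs_comp Fk Fa) Ff')) => y Qy /=.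
  by rewrite -tE ?kf //; apply: hom_mem Fk Qy.
rewrite -tA => -[/morphimP[a _ Aa ->] Fa']; exists a => //; apply/AutFGP => //.
split=> //; apply: (fs_ext _ (fs_comp (fs_comp Ff' Fa') Fk)) => u Pu /=.
by rewrite tE // fk // Aut_closed.
Qed.

Lemma im_perm P a : a \in Aut P -> im a P = P.
Proof.
move=> Aa; apply: group_inj; rewrite /= -[RHS]genGid -{2}(im_autm Aa).
by rewrite morphimEdom.
Qed.

Lemma eq_transport P f a a' b' : F P S f -> a \in Aut P -> a' \in Aut (im f P) ->
    b' \in Aut (im f P) ->
  {in P, forall u, a' (f u) = f (a u)} -> {in P, forall u, b' (f u) = f (a u)} ->
  a' = b'.
Proof.
move=> Ff Aa Aa' Ab' ra rb; apply: (eq_Aut Aa' Ab') => y.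
by rewrite (hom_im Ff) => /imsetP[u Pu ->]; rewrite ra ?rb.
Qed.

Definition OpAut P : {group {perm gT}} := [group of 'O_p(AutFG P)].

(* The group [N_S^K(P)] of the literature, for [K = O_p(Aut_F(P))]. *)
Definition NOp P : {group gT} := [group of S :&: conj_aut P @*^-1 OpAut P].

Lemma NOpP P g : reflect [/\ g \in S, g \in 'N(P) & conj_aut P g \in OpAut P] (g \in NOp P).
Proof.
by rewrite !inE; apply: (iffP and3P).
Qed.

Lemma NOp_sub P : NOp P \subset 'N_S(P).
Proof. by apply/subsetP=> g /NOpP[Sg Ng _]; rewrite inE Sg. Qed.

Lemma conj_aut_AutFG P g : P \subset S -> g \in 'N_S(P) -> conj_aut P g \in AutFG P.
Proof.
move=> sPS Ng; apply: (subsetP (AutS_sub_AutFG sPS)).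
by rewrite AutSE mem_morphim //; case/setIP: Ng.
Qed.

(** Elements of ['N_S(P)] act on [P] through [Aut_F(P)], which normalizes its [O_p]. *)
Lemma NOp_normal P : P \subset S -> NOp P <| 'N_S(P).
Proof.
move=> sPS; apply/normalP; split=> [|g Ng]; first exact: NOp_sub.
have [Sg nPg] := setIP Ng.
apply/eqP; rewrite eqEcard cardJg leqnn andbT; apply/subsetP=> _ /imsetP[m Mm ->].
have [Sm nPm Bm] := NOpP _ _ Mm; apply/NOpP; split; rewrite ?groupJ //.
rewrite morphJ // memJ_norm //; apply: (subsetP (normal_norm (pcore_normal _ _))).
exact: conj_aut_AutFG.
Qed.

Lemma Inn_normal P : P \subset S -> conj_aut P @* P <| AutFG P.
Proof.
move=> sPS; have sN : P \subset 'N_S(P) by rewrite subsetI sPS normG.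
apply/normalP; split=> [|a Ga].
  by apply/subsetP=> _ /morphimP[x _ Px ->]; apply: conj_aut_AutFG; rewrite // (subsetP sN).
apply/eqP; rewrite eqEcard cardJg leqnn andbT; apply/subsetP=> _ /imsetP[b Bb ->].
have [Aa _] := AutFGP _ sPS Ga.
have [x Nx Px ->] := morphimP Bb.
have Pax : a x \in P by apply: Aut_closed.
suff ->: conj_aut P x ^ a = conj_aut P (a x) by rewrite mem_morphim ?(subsetP (normG P)).
apply: eq_Aut (groupJ _ _) (conj_aut_Aut _) _ => //; rewrite ?conj_aut_Aut //.
  exact: (subsetP (normG P)).
move=> u Pu; rewrite norm_conj_autE //; last exact: (subsetP (normG P)).
have Au : a^-1 u \in P by rewrite Aut_closed ?groupV.
rewrite !permM norm_conj_autE //.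
have -> : a (a^-1 u ^ x) = a (a^-1 u) ^ a x := morphJ (autm_morphism Aa) Au Px.
by rewrite permKV.
Qed.

Lemma Inn_sub_OpAut P : P \subset S -> conj_aut P @* P \subset OpAut P.
Proof.
move=> sPS; apply: pcore_max (Inn_normal sPS).
by rewrite morphim_pgroup // (pgroupS sPS).
Qed.

Lemma sub_NOp P : P \subset S -> P \subset NOp P.
Proof.
move=> sPS; apply/subsetP=> x Px; have nPx := subsetP (normG P) x Px.
apply/NOpP; split=> //; first exact: (subsetP sPS).
by apply: (subsetP (Inn_sub_OpAut sPS)); rewrite mem_morphim.
Qed.

Lemma cent_sub_NOp P : 'C_S(P) \subset NOp P.
Proof.
apply/subsetP=> x /setIP[Sx Cx]; apply/NOpP; split=> //.
  exact: (subsetP (cent_sub P)).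
suff -> : conj_aut P x = 1 by rewrite group1.
by apply/(kerP (conj_aut_morphism P)); rewrite ?ker_conj_aut ?(subsetP (cent_sub P)).
Qed.

Lemma transport_OpAut P f b : F P S f -> b \in OpAut P ->
  exists2 b', b' \in OpAut (im f P) & {in P, forall u, b' (f u) = f (b u)}.
Proof.
move=> Ff Bb; have sPS := hom_src Ff; have [t [tI _ tG tE]] := transport Ff.
have Ab : b \in Aut P.
  by apply: (subsetP (AutFG_sub_Aut sPS)); apply: (subsetP (pcore_sub _ _)) Bb.
exists (t b) => [|u Pu]; last exact: tE.
by rewrite /= -tG -(injm_pcore tI p (AutFG_sub_Aut sPS)) mem_morphim.
Qed.

(** [O_p] is invariant under isomorphisms: transport along [f] takes [O_p(Aut_F(P))] to that of the
    image, and conjugation by [g] to conjugation by [f g]. *)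
Lemma im_NOp W P f g : F W S f -> P \subset W -> g \in W -> g \in NOp P ->
  f g \in NOp (im f P).
Proof.
move=> Ff sPW Wg /NOpP[Sg nPg Bg].
have FP := hom_sub Ff sPW; have [b' Bb' bE] := transport_OpAut FP Bg.
have Nfg : f g \in 'N(im f P).
  apply/normP/eqP; rewrite eqEcard cardJg leqnn andbT {1}(hom_im FP).
  apply/subsetP=> _ /imsetP[_ /imsetP[u Pu ->] ->].
  by rewrite -(homJ Ff) ?(subsetP sPW u) // mem_im // memJ_norm.
apply/NOpP; split=> //; first exact: hom_mem Ff _.
suff <- : b' = conj_aut (im f P) (f g) by [].
have sQS := hom_im_sub FP.
have Ab' : b' \in Aut (im f P).
  by apply: (subsetP (AutFG_sub_Aut sQS)); apply: (subsetP (pcore_sub _ _)) Bb'.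
apply: (eq_transport FP (conj_aut_Aut nPg) Ab' (conj_aut_Aut Nfg)) => // u Pu.
by rewrite !norm_conj_autE ?mem_im // (homJ Ff) ?(subsetP sPW u).
Qed.

Lemma im_NOp_sub W P f : F W S f -> P \subset W -> W \subset NOp P ->
  im f W \subset NOp (im f P).
Proof.
move=> Ff sPW sW; rewrite (hom_im Ff); apply/subsetP=> _ /imsetP[g Wg ->].
by apply: (im_NOp Ff) => //; apply: (subsetP sW).
Qed.

End AutomorphismGroups.

(** * Relatively fully normalized pairs, and extension of morphisms *)

Section FullyNormalizedPairs.

Variables (p : nat) (gT : finGroupType) (S : {group gT}) (F : fusion_system S).
Hypothesis pS : p.-group S.
Implicit Types (P Q R V W : {group gT}) (f : gT -> gT) (a b : {perm gT}) (g : gT).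

(** ['P] is the natural action of permutations, so [P] is stabilized as a set. When [P] is normal in
    [Q], these are the automorphisms of [Q] in [N_F(P)]. *)
Definition stab Q P : {group {perm gT}} := [group of 'N_(AutFG F Q)(P | 'P)].

Lemma stabP Q P a :
  reflect (a \in AutFG F Q /\ {in P, forall x, a x \in P}) (a \in stab Q P).
Proof.
rewrite inE; apply: (iffP andP) => -[Ga].
  by move/astabs_act=> nPa; split=> // x Px; rewrite [a x \in P]nPa.
move=> aP; split=> //; rewrite !inE /=; apply/subsetP=> x Px.
by rewrite inE; apply: aP.
Qed.

Lemma stab_im Q P a : Q \subset S -> P \subset Q -> a \in stab Q P -> im a P = P.
Proof.
move=> sQS sPQ /stabP[/AutFGP[]// Aa Fa aP]; apply: group_inj.
rewrite (im_sub Fa sPQ); apply/eqP; rewrite eqEcard card_imset ?leqnn ?andbT //.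
  by apply/subsetP=> _ /imsetP[x Px ->]; apply: aP.
exact: perm_inj.
Qed.

Lemma stab_conj_sub Q P x : Q \subset S -> P \subset Q -> x \in AutFG F Q ->
  stab Q P :^ x \subset stab Q (im x P).
Proof.
move=> sQS sPQ Gx; have [Ax Fx] := AutFGP _ _ sQS Gx.
apply/subsetP=> _ /imsetP[a /stabP[Ga aP] ->]; apply/stabP; split.
  exact: groupJ.
move=> y; rewrite {1}(im_sub Fx sPQ) => /imsetP[u Pu ->].
by rewrite permJ mem_im // aP.
Qed.

Lemma stab_conj Q P x : Q \subset S -> P \subset Q -> x \in AutFG F Q ->
  stab Q (im x P) = stab Q P :^ x :> {set {perm gT}}.
Proof.
move=> sQS sPQ Gx; have [Ax Fx] := AutFGP _ _ sQS Gx.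
have sxQ : im x P \subset Q by apply: hom_im_sub (hom_sub Fx sPQ).
apply/esym/eqP; rewrite eqEcard stab_conj_sub //= cardJg.
rewrite -(cardJg (stab _ (im x P)) x^-1) subset_leq_card //.
have {2}-> : P = im x^-1 (im x P).
  rewrite -(im_comp _ Fx sPQ) -[LHS]im_id.
  by apply: eq_im => u _ /=; rewrite permK.
by apply: stab_conj_sub; rewrite ?groupV.
Qed.

Lemma AutS_stab Q P : Q \subset S -> P \subset Q -> AutS 'N_S(P)%G Q \subset stab Q P.
Proof.
move=> sQS sPQ; apply/subsetP=> a Sa; apply/stabP; split.
  by apply: (subsetP (AutS_sub_AutFG F sQS)); apply: (subsetP (AutS_sub _ (subsetIl _ _))) Sa.
have [_ [h /setIP[_ Nh] ah]] := AutS_memP _ _ _ Sa.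
by move=> x Px; rewrite ah ?memJ_norm // (subsetP sPQ).
Qed.

Lemma AutS_stab_mem Q P a h : Q \subset S -> P \subset Q -> h \in S ->
    a \in stab Q P -> {in Q, forall u, a u = u ^ h} ->
  a \in AutS 'N_S(P)%G Q.
Proof.
move=> sQS sPQ Sh /stabP[/AutFGP[]// Aa _ aP] ah; apply/AutS_memP; split=> //.
exists h => //; rewrite inE Sh; apply/normP/eqP.
rewrite eqEcard cardJg leqnn andbT; apply/subsetP=> _ /imsetP[u Pu ->].
by rewrite -ah ?aP ?(subsetP sPQ).
Qed.

(* [Q] behaves like a fully normalized subgroup of the fusion system [N_F(P)]. *)
Definition fn_pair Q P : Prop :=
  fully_centralized F Q /\ p.-Sylow(stab Q P) (AutS 'N_S(P)%G Q).

Variable n : nat.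
Hypothesis sat : forall Q, Q \subset S -> n < #|Q| ->
  saturation_I p F Q /\ saturation_II F Q.

(** A fully normalized conjugate [Q0] of [Q] has [Aut_S(Q0)] Sylow in [Aut_F(Q0)]. Some [x]
    conjugates a Sylow subgroup of the stabilizer into it. Once the image of [P] is moved by [x]
    too, this is a Sylow subgroup of the new stabilizer induced by [S], hence by the normalizer of
    the new image. *)
Lemma exists_fn_pair Q P : P \subset Q -> Q \subset S -> n < #|Q| ->
  exists2 f, F Q S f & fn_pair (im f Q) (im f P).
Proof.
move=> sPQ sQS ltn; have [Q0 cQ nQ0] := exists_fully_normalized F sQS.
have [_ sQ0] := conj_sub cQ.
have [|[//|cQ0 sylQ0] _] := sat sQ0; first by rewrite -(conj_card cQ).
have [f Ff eQ0] := (conjP F Q Q0).1 cQ.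
have sP0 : im f P \subset Q0 by rewrite -eQ0; apply: imS Ff sPQ (subxx _).
have [T sylT] := Sylow_exists p (stab Q0 (im f P)).
have sTG : T \subset AutFG F Q0 by apply: subset_trans (pHall_sub sylT) (subsetIl _ _).
rewrite -AutFGE // in sylQ0.
have [x Gx sTx] := Sylow_Jsub sylQ0 sTG (pHall_pgroup sylT).
have [Ax Fx] := AutFGP _ _ sQ0 Gx; have FxS := homS Fx.
rewrite -eQ0 in FxS; exists (x \o f); first exact: hom_compim Ff FxS.
rewrite (im_comp _ Ff sPQ) (im_comp _ Ff (subxx _)) eQ0 (im_perm Ax).
split=> //.
have sP3 : im x (im f P) \subset Q0 by apply: hom_im_sub (hom_sub Fx sP0).
have sylTx : p.-Sylow(stab Q0 (im x (im f P))) (T :^ x).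
  by rewrite (stab_conj sQ0) // pHallJ2.
have sTxN : T :^ x \subset AutS 'N_S(im x (im f P))%G Q0.
  apply/subsetP=> a Ta; have sa := subsetP (pHall_sub sylTx) a Ta.
  have [_ [h Sh ah]] := AutS_memP _ _ _ (subsetP sTx a Ta).
  exact: AutS_stab_mem ah.
have pN : p.-group (AutS 'N_S(im x (im f P))%G Q0).
  by rewrite AutS_p // (pgroupS (subsetIl _ _)).
by rewrite (sub_pHall sylTx pN sTxN (AutS_stab sQ0 sP3)).
Qed.

(** Through [f], the group [W] acts on [Q] as a [p]-subgroup of [Z]. Since [AutS 'N_S(P) Q] is Sylow
    in [Z], some [z] in [Z] conjugates this action into it, and then [z \o f] satisfies the
    condition of axiom II on [W]. The choice of [Z] limits how far the extension departs from
    [f]. *)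
Lemma fn_pair_ext_upto Q P Q1 P1 f W (Z : {group {perm gT}}) :
    fn_pair Q P -> P \subset Q -> F Q1 S f -> im f Q1 = Q -> P1 \subset Q1 -> im f P1 = P ->
    n < #|Q| -> W \subset 'N_S(Q1) -> Q1 \subset W ->
    AutS 'N_S(P)%G Q \subset Z -> Z \subset stab Q P ->
    (forall g a, g \in W -> a \in AutFG F Q -> {in Q1, forall u, a (f u) = f (u ^ g)} ->
       a \in Z) ->
  exists2 z, z \in Z & exists2 f', F W S f' & {in Q1, forall u, f' u = z (f u)}.
Proof.
move=> [cQ sylQ] sPQ Ff eQ sPQ1 eP ltn sWN sQ1W sTZ sZ hW.
have sQ1S := hom_src Ff; have sQS : Q \subset S by rewrite -eQ (hom_im_sub Ff).
have sWS : W \subset S by apply: subset_trans sWN (subsetIl _ _).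
have nWQ1 : W \subset 'N(Q1) by apply: subset_trans sWN (subsetIr _ _).
have [t [tI tA tG tE]] := transport Ff.
have tcE g : g \in W -> t (conj_aut Q1 g) \in AutFG F Q /\
    {in Q1, forall u, t (conj_aut Q1 g) (f u) = f (u ^ g)}.
  move=> Wg; have Ng := subsetP sWN g Wg; have nQ1g := subsetP nWQ1 g Wg.
  have Ac := conj_aut_Aut nQ1g.
  split=> [|u Qu]; last by rewrite tE // norm_conj_autE.
  by rewrite -eQ -tG mem_morphim // conj_aut_AutFG.
pose A1 := (t @* (conj_aut Q1 @* W))%G.
have pA1 : p.-group A1 by rewrite !morphim_pgroup // (pgroupS sWS).
have sA1 : A1 \subset Z.
  apply/subsetP=> _ /morphimP[_ _ /morphimP[g _ Wg ->] ->].
  by have [] := tcE g Wg; apply: hW.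
have sylZ := pHall_subl sTZ sZ sylQ.
have [z Zz sA1z] := Sylow_Jsub sylZ sA1 pA1.
have Gz : z \in AutFG F Q by have /stabP[] := subsetP sZ z Zz.
have [Az Fz] := AutFGP _ _ sQS Gz.
have FzS : F (im f Q1) S z by rewrite eQ; apply: homS Fz.
have Fzf := hom_compim Ff FzS.
exists z => //; apply: ext_II (Fzf) _ sWN _.
- by have [] := sat sQ1S; rewrite -?(card_im Ff) ?eQ.
- by rewrite (im_comp _ Ff (subxx _)) eQ (im_perm Az).
move=> g Wg; have [Ga aE] := tcE g Wg.
have : t (conj_aut Q1 g) ^ z \in AutS 'N_S(P)%G Q.
  apply: (subsetP sA1z); rewrite memJ_conjg mem_morphim //.
    by apply: conj_aut_Aut; apply: (subsetP nWQ1).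
  by rewrite mem_morphim // (subsetP nWQ1).
case/AutS_memP=> _ [h /setIP[Sh _] hE]; exists h => // u Qu /=.
rewrite -aE // -permJ hE // Aut_closed // -eQ mem_im //.
Qed.

(** With the whole stabilizer as [Z], the correction [z] may move elements of [P], but it keeps [P]
    and [Q] as sets. *)
Lemma fn_pair_norm Q P Q1 P1 f :
    fn_pair Q P -> F Q1 S f -> im f Q1 = Q -> P1 \subset Q1 -> im f P1 = P ->
    n < #|Q| -> Q1 \subset 'N(P1) ->
  exists f', [/\ F ('N_S(P1) :&: 'N(Q1))%G S f', im f' Q1 = Q & im f' P1 = P].
Proof.
move=> gQ Ff eQ sPQ1 eP ltn nPQ1; set W := ('N_S(P1) :&: _)%G.
have sQ1S := hom_src Ff; have sQS : Q \subset S by rewrite -eQ (hom_im_sub Ff).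
have sPQ : P \subset Q by rewrite -eQ -eP; apply: imS Ff sPQ1 (subxx _).
have sQ1W : Q1 \subset W by rewrite /= !subsetI sQ1S nPQ1 normG.
have sWN : W \subset 'N_S(Q1) by apply: setSI (subsetIl _ _).
have [|z Zz [f' Ff' f'E]] :=
  fn_pair_ext_upto gQ sPQ Ff eQ sPQ1 eP ltn sWN sQ1W (AutS_stab sQS sPQ) (subxx _).
  move=> g a /setIP[/setIP[_ nPg] nQg] Ga aE; apply/stabP; split=> // y.
  rewrite -{1}eP (im_sub Ff sPQ1) => /imsetP[u Pu ->].
  by rewrite aE ?(subsetP sPQ1) // -eP mem_im // memJ_norm.
have /stabP[/(AutFGP _ _ sQS)[Az _] _] := Zz.
exists f'; split=> //.
  by rewrite (eq_im f'E) -[RHS](im_perm Az) -eQ; apply: im_comp Ff _.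
rewrite -[RHS](stab_im sQS sPQ Zz) -eP -(im_comp _ Ff sPQ1).
by apply: eq_im => u Pu; apply: f'E; apply: (subsetP sPQ1).
Qed.

Lemma stab_astabs Q P : stab Q P \subset 'N(P | 'P).
Proof. exact: subsetIr. Qed.

Lemma restr_stabE Q P a : a \in stab Q P -> {in P, restr_perm P a =1 a}.
Proof.
move=> sa u Pu; apply: restr_permE => //.
exact: (subsetP (stab_astabs _ _)) sa.
Qed.

Lemma restr_stab_AutFG Q P : Q \subset S -> P \subset Q ->
  restr_perm P @* stab Q P \subset AutFG F P.
Proof.
move=> sQS sPQ; have sPS := subset_trans sPQ sQS.
apply/subsetP=> _ /morphimP[a _ sa ->]; have [/(AutFGP _ _ sQS)[Aa Fa] aP] := stabP _ _ _ sa.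
apply/AutFGP => //; split; first exact: (Aut_restr_perm sPQ).
apply: (fs_ext _ (hom_tgt (hom_sub Fa sPQ) sPS aP)) => u Pu.
by rewrite (restr_stabE sa).
Qed.

Lemma restr_AutSP Q P a : Q \subset S -> P \subset Q -> a \in stab Q P ->
  reflect (exists h, [/\ h \in 'N_S(P), h \in 'N(Q) & {in P, forall u, a u = u ^ h}])
          (restr_perm P a \in restr_perm P @* AutS 'N_S(P)%G Q).
Proof.
move=> sQS sPQ sa; have sT := AutS_stab sQS sPQ; rewrite AutSE.
have AutR b : b \in stab Q P -> restr_perm P b \in Aut P.
  by case/stabP=> /(AutFGP _ _ sQS)[Ab _] _; apply: (Aut_restr_perm sPQ).
apply: (iffP idP) => [/morphimP[b _ /morphimP[h Nh /setIP[Sh _] ->] eab] | [h [Sh Nh ah]]].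
  have sh : conj_aut Q h \in stab Q P.
    by apply: (subsetP sT); rewrite AutSE mem_morphim // inE Sh.
  exists h; split=> // u Pu; rewrite -(restr_stabE sa) // eab (restr_stabE sh) //.
  by rewrite norm_conj_autE // (subsetP sPQ).
have Th : conj_aut Q h \in AutS 'N_S(P)%G Q by rewrite AutSE mem_morphim // inE Sh.
have sh := subsetP sT _ Th.
suff ->: restr_perm P a = restr_perm P (conj_aut Q h).
  by rewrite mem_morphim ?(subsetP (stab_astabs _ _) _ sh) // -AutSE.
apply: (eq_Aut (AutR _ sa) (AutR _ sh)) => u Pu.
rewrite (restr_stabE sa) // (restr_stabE sh) // ah // norm_conj_autE //.
exact: (subsetP sPQ).
Qed.

(* Conjugating into the Sylow subgroup only inside [Z], the automorphisms that agree on [P]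
   with some [c_h], changes [f] on [P1] by a [c_h], which is undone in [S]. *)
Lemma fn_pair_ext Q P Q1 P1 f W :
    fn_pair Q P -> F Q1 S f -> im f Q1 = Q -> P1 \subset Q1 -> im f P1 = P ->
    n < #|Q| -> W \subset 'N_S(Q1) -> Q1 \subset W ->
    {in W, forall g, exists h,
       [/\ h \in 'N_S(P), h \in 'N(Q) & {in P1, forall u, f (u ^ g) = f u ^ h}]} ->
  exists2 f', F W S f' & {in P1, f' =1 f}.
Proof.
move=> gQ Ff eQ sPQ1 eP ltn sWN sQ1W hW.
have sQ1S := hom_src Ff; have sQS : Q \subset S by rewrite -eQ (hom_im_sub Ff).
have sPQ : P \subset Q by rewrite -eQ -eP; apply: imS Ff sPQ1 (subxx _).
pose r := restr_perm_morphism P; pose T := AutS_group 'N_S(P)%G Q.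
pose Z := (stab Q P :&: r @*^-1 (r @* T))%G.
have sT := AutS_stab sQS sPQ.
have sTZ : T \subset Z.
  rewrite subsetI sT -sub_morphim_pre /=; first exact: subxx.
  exact: (subset_trans sT (stab_astabs Q P)).
have [|z /setIP[sz Zz] [f' Ff' f'E]] :=
  fn_pair_ext_upto gQ sPQ Ff eQ sPQ1 eP ltn sWN sQ1W sTZ (subsetIl _ _).
  move=> g a Wg Ga aE; have [h [Sh Nh hE]] := hW g Wg.
  have aP : {in P, forall u, a u = u ^ h}.
    move=> y; rewrite -{1}eP (im_sub Ff sPQ1) => /imsetP[u Pu ->].
    by rewrite aE ?hE ?(subsetP sPQ1).
  have sa : a \in stab Q P.
    apply/stabP; split=> // u Pu; rewrite aP // memJ_norm //.
    by case/setIP: Sh.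
  rewrite inE sa inE (subsetP (stab_astabs _ _) _ sa) inE /=.
  by apply/restr_AutSP => //; exists h.
have [h [Sh Nh zE]] : exists h, [/\ h \in 'N_S(P), h \in 'N(Q) & {in P, forall u, z u = u ^ h}].
  by apply/restr_AutSP => //; case/morphpreP: Zz.
have Sh' : h^-1 \in S by rewrite groupV; case/setIP: Sh.
exists (conjg^~ h^-1 \o f') => [|u Pu /=].
  exact: hom_compim Ff' (homJx F (hom_im_sub Ff') Sh').
by rewrite f'E ?(subsetP sPQ1) // zE ?conjgK // -eP mem_im.
Qed.

(** The condition of [fn_pair_ext] holds on [Q1] through [f] itself. It holds on [NOp p F P1]
    because [O_p(Aut_F(P))] meets the restrictions of the stabilizer in a normal [p]-subgroup, and
    this lies in the image of the Sylow subgroup. *)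
Lemma fn_pair_NOp Q P Q1 P1 f W :
    fn_pair Q P -> F Q1 S f -> im f Q1 = Q -> P1 \subset Q1 -> im f P1 = P ->
    n < #|Q| -> Q1 \subset 'N(P1) -> W \subset 'N_S(Q1) -> Q1 \subset W ->
    W \subset Q1 * NOp p F P1 ->
  exists2 f', F W S f' & {in P1, f' =1 f}.
Proof.
move=> gQ Ff eQ sPQ1 eP ltn nPQ1 sWN sQ1W sWB.
apply: (fn_pair_ext gQ Ff eQ sPQ1 eP ltn sWN sQ1W) => g Wg.
have sQ1S := hom_src Ff; have sQS : Q \subset S by rewrite -eQ (hom_im_sub Ff).
have sPQ : P \subset Q by rewrite -eQ -eP; apply: imS Ff sPQ1 (subxx _).
have sPS := subset_trans sPQ sQS.
have [q m Qq Mm def_g] := mulsgP (subsetP sWB g Wg).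
have nQ1g : g \in 'N(Q1) by case/setIP: (subsetP sWN g Wg).
have nQ1m : m \in 'N(Q1) by rewrite -(groupMl _ (subsetP (normG Q1) q Qq)) -def_g.
have [Sm nPm Bm] := NOpP _ _ _ _ Mm.
have [t [tI tA tG tE]] := transport Ff.
have Ac := conj_aut_Aut nQ1m.
pose a := t (conj_aut Q1 m).
have aE : {in Q1, forall u, a (f u) = f (u ^ m)}.
  by move=> u Qu; rewrite tE // norm_conj_autE.
have sa : a \in stab Q P.
  apply/stabP; split=> [|y].
    by rewrite -eQ -tG mem_morphim // conj_aut_AutFG // inE Sm.
  rewrite -{1}eP (im_sub Ff sPQ1) => /imsetP[u Pu ->].
  by rewrite aE ?(subsetP sPQ1) // -eP mem_im // memJ_norm.
have [b' Bb' bE] := transport_OpAut (hom_sub Ff sPQ1) Bm; rewrite eP in Bb'.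
have sBP : restr_perm P @* stab Q P :&: OpAut p F P \subset restr_perm P @* AutS 'N_S(P)%G Q.
  have sT := AutS_stab sQS sPQ.
  have syl := morphim_pHall (restr_perm_morphism P)
                (subset_trans sT (stab_astabs _ _)) gQ.2.
  apply: (normal_sub_max_pgroup (Hall_max syl)).
    exact: pgroupS (subsetIr _ _) (pcore_pgroup _ _).
  exact: normalGI (restr_stab_AutFG sQS sPQ) (pcore_normal _ _).
have rab : restr_perm P a = b'.
  have Gr : restr_perm P a \in AutFG F P.
    apply: (subsetP (restr_stab_AutFG sQS sPQ)); rewrite mem_morphim //.
    exact: (subsetP (stab_astabs _ _)) sa.
  apply: (eq_Aut (A := P)).
  - exact: (subsetP (AutFG_sub_Aut F sPS)) Gr.
  - by apply: (subsetP (AutFG_sub_Aut F sPS)); apply: (subsetP (pcore_sub _ _)) Bb'.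
  move=> y Py; rewrite (restr_stabE sa) //.
  move: Py; rewrite -{1}eP (im_sub Ff sPQ1) => /imsetP[u Pu ->].
  by rewrite bE // norm_conj_autE // aE // (subsetP sPQ1).
have /(restr_AutSP sQS sPQ sa)[h [Sh Nh hE]] :
    restr_perm P a \in restr_perm P @* AutS 'N_S(P)%G Q.
  apply: (subsetP sBP); rewrite inE {2}rab Bb' andbT mem_morphim //.
  exact: (subsetP (stab_astabs _ _)) sa.
have nPQ : Q \subset 'N(P) by rewrite -eQ -eP; apply: im_norm Ff sPQ1 nPQ1.
have Qfq : f q \in Q by rewrite -eQ mem_im.
(* [g] is [q * m]: under [f], conjugation by [q] becomes conjugation by [f q], and that by [m]
   agrees on [P] with conjugation by [h]. *)
exists (f q * h); split.
- by rewrite groupM // inE (subsetP sQS) // (subsetP nPQ).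
- by rewrite groupM // (subsetP (normG Q)).
move=> u Pu; have Quq : u ^ q \in P1 by rewrite memJ_norm // (subsetP nPQ1).
rewrite def_g !conjgM -aE ?(subsetP sPQ1) // hE; last by rewrite -eP mem_im.
by rewrite (homJ Ff) // (subsetP sPQ1).
Qed.

End FullyNormalizedPairs.

(** * Morphisms defined beyond [P]: confluence, and extension to [NOp] *)

Section Links.

Variables (p : nat) (gT : finGroupType) (S : {group gT}) (F : fusion_system S).
Hypothesis pS : p.-group S.
Implicit Types (P Q R T V W : {group gT}) (f k : gT -> gT) (g : gT).

Lemma im_inv P Q f k W : F P Q f -> {in P, cancel f k} -> W \subset P ->
  im k (im f W) = W.
Proof.
move=> Ff fk sWP; rewrite -(im_comp _ Ff sWP) -[RHS]im_id.
by apply: eq_im => x Wx /=; apply: fk; apply: (subsetP sWP).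
Qed.

Lemma sub_normS P : P \subset S -> P \subset 'N_S(P).
Proof. by move=> sPS; rewrite subsetI sPS normG. Qed.

Lemma im_normS P W f : F W S f -> P \subset W -> W \subset 'N(P) ->
  im f W \subset 'N_S(im f P).
Proof. by move=> Ff sPW nPW; rewrite subsetI (hom_im_sub Ff) (im_norm Ff). Qed.

(** The preorder of the confluence argument: a link from [P] to [R] with the largest domain that
    normalizes [P]. Its image lies in ['N_S(R)]. *)
Definition to_norm P R : Prop := exists2 f, F 'N_S(P)%G S f & im f P = R.

Lemma to_norm_refl P : P \subset S -> to_norm P P.
Proof. by move=> sPS; exists id; rewrite ?im_id //; apply: hom_incl (subsetIl _ _) _. Qed.

Lemma to_norm_sub P R f : P \subset S -> F 'N_S(P)%G S f -> im f P = R ->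
  im f 'N_S(P) \subset 'N_S(R).
Proof. by move=> sPS Ff <-; apply: im_normS (sub_normS sPS) (subsetIr _ _). Qed.

Lemma to_norm_trans P R T : P \subset S -> to_norm P R -> to_norm R T -> to_norm P T.
Proof.
move=> sPS [f Ff eR] [k Fk eT]; exists (k \o f).
  by apply: (hom_compim Ff (hom_sub Fk _)); apply: to_norm_sub Ff eR.
by rewrite (im_comp _ Ff (sub_normS sPS)) eR.
Qed.

Lemma to_norm_conj P R : P \subset S -> to_norm P R -> fs_conj F P R.
Proof.
move=> sPS [f Ff eR]; apply/conjP; exists f => //.
exact: hom_sub Ff (sub_normS sPS).
Qed.

Lemma proper_normI Q W : W \subset S -> Q \proper W -> Q \proper W :&: 'N(Q).
Proof.
by move=> sWS; apply: nilpotent_proper_norm; apply: pgroup_nil (pgroupS sWS pS).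
Qed.

Variable n : nat.
Hypothesis sat : forall Q, Q \subset S -> n < #|Q| ->
  saturation_I p F Q /\ saturation_II F Q.

(* Newman's lemma: if neither [f] nor its inverse is defined on a full normalizer, then
   [P] and [im f P] have links of larger domain to a third subgroup [im r P]; the two
   upper bounds so obtained are again linked, on the whole image of [N_S(im r P)]. *)
Lemma common_norm Q P f : F Q S f -> P \subset Q -> Q \subset 'N(P) -> n < #|Q| ->
  exists R, to_norm P R /\ to_norm (im f P) R.
Proof.
have [m] := ubnP (#|S| - #|Q|).
elim: m Q P f => // m IHm Q P f lem Ff sPQ nPQ ltn.
have sQS := hom_src Ff; have sPS := subset_trans sPQ sQS.
have IH V R k : F V S k -> R \subset V -> V \subset 'N(R) -> #|Q| < #|V| ->
    exists T, to_norm R T /\ to_norm (im k R) T.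
  move=> Fk sRV nRV ltQV; apply: (IHm V) => //; last exact: ltn_trans ltQV.
  rewrite -ltnS (leq_trans _ lem) // ltnS ltn_sub2l //.
  by rewrite (leq_trans ltQV) // subset_leq_card // (hom_src Fk).
have [Ff' [k [Fk fk kf]]] := hom_factor Ff.
set Q2 := im f Q in Ff' Fk kf; set P2 := im f P.
have sP2Q : P2 \subset Q2 by apply: imS Ff sPQ _.
have sQ2S : Q2 \subset S := hom_im_sub Ff.
have sP2S := subset_trans sP2Q sQ2S.
have nPQ2 : Q2 \subset 'N(P2) by apply: im_norm Ff sPQ nPQ.
have eP : im k P2 = P by apply: im_inv Ff fk sPQ.
have sQN : Q \subset 'N_S(P) by rewrite subsetI sQS.
have sQ2N : Q2 \subset 'N_S(P2) by rewrite subsetI sQ2S.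
(* If [f] or its inverse is defined on a full normalizer, it already leads to a common target. *)
have [eQN | ltQN] := eqVproper sQN.
  exists P2; split; last exact: to_norm_refl.
  by exists f => //; apply: hom_sub Ff _; rewrite eQN.
have [eQ2 | ltQ2] := eqVproper sQ2N.
  exists P; split; first exact: to_norm_refl.
  by exists k => //; apply: hom_sub (homS Fk) _; rewrite eQ2.
(* [r] and [r \o k] send [(Q, P)] and [(Q2, P2)] to the same good pair, so [fn_pair_norm] enlarges
   the domains of both. *)
have [r Fr gr] := exists_fn_pair pS sat sPQ sQS ltn.
have ltnr : n < #|im r Q| by rewrite (card_im Fr).
have [f1 [Ff1 eQ1 eP1]] := fn_pair_norm pS sat gr Fr erefl sPQ erefl ltnr nPQ.
have Frk : F Q2 S (r \o k) := fs_comp Fk Fr.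
have eQk : im (r \o k) Q2 = im r Q.
  by rewrite (im_comp _ Fk (subxx _)) (im_inv Ff fk (subxx _)).
have ePk : im (r \o k) P2 = im r P by rewrite (im_comp _ Fk sP2Q) eP.
have [f2 [Ff2 eQ2 eP2]] := fn_pair_norm pS sat gr Frk eQk sP2Q ePk ltnr nPQ2.
have [||R1 [nR1 nR1']] := IH _ _ _ Ff1 _ (subset_trans (subsetIl _ _) (subsetIr _ _)).
- by rewrite subsetI (sub_normS sPS) (subset_trans sPQ) // normG.
- by apply: proper_card (proper_normI (subsetIl _ _) ltQN).
have [||R2 [nR2 nR2']] := IH _ _ _ Ff2 _ (subset_trans (subsetIl _ _) (subsetIr _ _)).
- by rewrite subsetI (sub_normS sP2S) (subset_trans sP2Q) // normG.
- rewrite -(card_im Ff); apply: proper_card (proper_normI (subsetIl _ _) ltQ2).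
rewrite eP1 in nR1'; rewrite eP2 in nR2'.
have sP3S : im r P \subset S := hom_im_sub (hom_sub Fr sPQ).
have [b1 Fb1 eR1] := nR1'; have [b2 Fb2 eR2] := nR2'.
have [Fb1' [k1 [Fk1 bk1 kb1]]] := hom_factor Fb1.
have sPN := sub_normS sP3S.
(* [b2] after the inverse of [b1] sends [R1] to [R2]. Its domain has the order of ['N_S(im r P)],
   into which [f1] embeds a group larger than [Q]. *)
have [||||R [nR1R]] := IH (im b1 'N_S(im r P)) R1 (b2 \o k1).
- exact: fs_comp Fk1 Fb2.
- by rewrite -eR1; apply: imS Fb1 sPN _.
- by rewrite -eR1; apply: im_norm Fb1 sPN (subsetIr _ _).
- rewrite (card_im Fb1) -eP1; apply: leq_trans (subset_leq_card (im_normS Ff1 _ _)).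
  + rewrite (card_im Ff1); apply: proper_card (proper_normI (subsetIl _ _) ltQN).
  + by rewrite subsetI (sub_normS sPS) (subset_trans sPQ) // normG.
  + exact: subset_trans (subsetIl _ _) (subsetIr _ _).
rewrite (im_comp _ Fk1) -?eR1; last exact: imS Fb1 sPN _.
rewrite (im_inv Fb1 bk1 sPN) eR2 => nR2R.
by exists R; split; [apply: to_norm_trans nR1 nR1R | apply: to_norm_trans nR2 nR2R].
Qed.

Definition top P : Prop := forall R, fs_conj F P R -> to_norm R P.

(** On [P], [f] is [f2] followed by the inverse of [f1], where [f1] starts from a group that
    properly contains the image of [Q], and [f2] from one that properly contains [Q]. Composed with
    a link [b] back to [P], both fix [P] as a set, so by induction on the domain their restrictions
    to [P] extend to [NOp p F P]. *)
Lemma link_extends Q P f : top P -> F Q S f -> im f P = P -> P \subset Q ->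
    Q \subset 'N(P) -> n < #|Q| ->
  exists2 f', F (NOp p F P) S f' & {in P, f' =1 f}.
Proof.
move=> topP; have [m] := ubnP (#|S| - #|Q|).
elim: m Q f => // m IHm Q f lem Ff eP sPQ nPQ ltn.
have sQS := hom_src Ff; have sPS := subset_trans sPQ sQS.
have IH V k : F V S k -> im k P = P -> P \subset V -> V \subset 'N(P) -> #|Q| < #|V| ->
    exists2 f', F (NOp p F P) S f' & {in P, f' =1 k}.
  move=> Fk ePk sPV nPV ltQV; apply: (IHm V) => //; last exact: ltn_trans ltQV.
  rewrite -ltnS (leq_trans _ lem) // ltnS ltn_sub2l //.
  by rewrite (leq_trans ltQV) // subset_leq_card // (hom_src Fk).
set M := NOp p F P in IH *; set N := 'N_S(P).
have sMN : M \subset N := NOp_sub _ _ _.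
have sPM : P \subset M by apply: sub_NOp.
have [sMQ | nsMQ] := boolP (M \subset Q); first by exists f => //; apply: hom_sub Ff _.
have sQN : Q \subset N by rewrite subsetI sQS.
have [Ff' _] := hom_factor Ff; set Q2 := im f Q in Ff'.
have sQ2S : Q2 \subset S := hom_im_sub Ff.
have sPQ2 : P \subset Q2 by rewrite -eP; apply: imS Ff sPQ _.
have nPQ2 : Q2 \subset 'N(P) by rewrite -eP; apply: im_norm Ff sPQ nPQ.
(* [Q2] has the order of [Q], and [Q] is proper in [N] because it does not contain [M]. *)
have ltQ2N : Q2 \proper N.
  rewrite properEcard subsetI sQ2S nPQ2 (card_im Ff) proper_card // properE sQN.
  by apply: contra nsMQ; apply: subset_trans.
have ltn2 : n < #|Q2| by rewrite (card_im Ff).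
have [r Fr gr] := exists_fn_pair pS sat sPQ2 sQ2S ltn2.
have ltnr : n < #|im r Q2| by rewrite (card_im Fr).
have [f1 [Ff1 eQ1 eP1]] := fn_pair_norm pS sat gr Fr erefl sPQ2 erefl ltnr nPQ2.
set W1 := ('N_S(P) :&: _)%G in Ff1.
have sPW1 : P \subset W1 by rewrite subsetI (sub_normS sPS) (subset_trans sPQ2) // normG.
have nPW1 : W1 \subset 'N(P) := subset_trans (subsetIl _ _) (subsetIr _ _).
have sQ2W1 : Q2 \subset W1 by rewrite subsetI (proper_sub ltQ2N) normG.
have Ff1f : F Q S (f1 \o f) := fs_comp Ff' (hom_sub Ff1 sQ2W1).
have eQf : im (f1 \o f) Q = im r Q2 by rewrite (im_comp _ Ff (subxx _)).
have ePf : im (f1 \o f) P = im r P by rewrite (im_comp _ Ff sPQ) eP.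
(* Staying inside [Q * M] lets [fn_pair_NOp] extend [f1 \o f] without changing it on [P]. *)
pose W2 := 'N_(Q <*> M)(Q)%G.
have nMQ : Q \subset 'N(M) by apply: subset_trans sQN (normal_norm (NOp_normal p F sPS)).
have sQMN : Q <*> M \subset N by rewrite join_subG sQN.
have sW2N : W2 \subset N := subset_trans (subsetIl _ _) sQMN.
have sQW2 : Q \subset W2 by rewrite subsetI joing_subl normG.
have [|||f2 Ff2 f2E] := fn_pair_NOp pS sat gr Ff1f eQf sPQ ePf ltnr nPQ (_ : W2 \subset _).
- by rewrite setSI // (subset_trans sQMN) // subsetIl.
- exact: sQW2.
- by rewrite /= norm_joinEl // subsetIl.
have [b Fb ebP] : to_norm (im r P) P.
  by apply: topP; apply/conjP; exists r => //; apply: hom_sub Fr sPQ2.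
have Fb1 : F W1 S (b \o f1).
  by apply: (hom_compim Ff1 (hom_sub Fb _)); rewrite -eP1; apply: im_normS Ff1 _ _.
have ePb1 : im (b \o f1) P = P by rewrite (im_comp _ Ff1 sPW1) eP1.
have sPW2 := subset_trans sPQ sQW2.
have eP2 : im f2 P = im r P by rewrite (eq_im f2E).
have nPW2 : W2 \subset 'N(P) := subset_trans sW2N (subsetIr _ _).
have Fb2 : F W2 S (b \o f2).
  by apply: (hom_compim Ff2 (hom_sub Fb _)); rewrite -eP2; apply: im_normS Ff2 _ _.
have ePb2 : im (b \o f2) P = P by rewrite (im_comp _ Ff2 sPW2) eP2.
have [|u Fu uE] := IH _ _ Fb1 ePb1 sPW1 nPW1.
  by rewrite -(card_im Ff); apply: proper_card (proper_normI (subsetIl _ _) ltQ2N).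
have [|v Fv vE] := IH _ _ Fb2 ePb2 sPW2 nPW2.
  apply: proper_card (proper_normI _ _); first exact: subset_trans sQMN (subsetIl _ _).
  by rewrite properE joing_subl join_subG subxx.
have im_M k : F M S k -> {in P, forall x, k x \in P} -> im k M \subset M.
  move=> Fk kP; have ek : im k P = P.
    apply/eqP; rewrite -val_eqE eqEcard (card_im (hom_sub Fk sPM)) leqnn andbT.
    by rewrite gen_subG; apply/subsetP=> _ /imsetP[x Px ->]; apply: kP.
  by have := im_NOp_sub Fk sPM (subxx _); rewrite ek.
have uM : im u M = M.
  apply/eqP; rewrite -val_eqE eqEcard (card_im Fu) leqnn andbT im_M // => x Px.
  by rewrite uE // -ePb1 mem_im.
have vM : im v M \subset M by apply: im_M => // x Px; rewrite vE // -ePb2 mem_im.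
(* [u] is an automorphism of [M]; in [v] followed by its inverse, [b] and [f1] cancel on [P]. *)
have [_ [k [Fk uk _]]] := hom_factor Fu; rewrite uM in Fk.
exists (k \o v); first exact: hom_compim Fv (homS (hom_sub Fk vM)).
move=> x Px; have Pfx : f x \in P by rewrite -eP mem_im.
by rewrite /= vE //= f2E //= -[b _]uE // uk // (subsetP sPM).
Qed.

End Links.

(** * From links to all morphisms, by [H]-generation *)

Section Generation.

Variables (p : nat) (gT : finGroupType) (S : {group gT}) (F : fusion_system S).
Hypothesis pS : p.-group S.
Implicit Types (P Q R T V W : {group gT}) (f k : gT -> gT) (g : gT).

Variables (H : {set {group gT}}) (n : nat).
Hypothesis H_conj : conj_closed F H.
Hypothesis H_gen : H_generated F H.
Hypothesis sat : forall Q, Q \subset S -> n < #|Q| ->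
  saturation_I p F Q /\ saturation_II F Q.
Hypothesis lt_nS : n < #|S|.

Lemma gen_hom P Q f : generated_by F H P Q f -> F P Q f.
Proof.
elim=> {P Q f} [P Q P1 Q1 f k _ _ Fk sP sQ kQ fk | P Q R f k h _ Ff _ Fk hE].
  have [_ sQ1S] := fs_obj Fk; apply: (@fs_ext _ _ F P Q k) => [x Px|]; first by rewrite fk.
  by apply: (hom_tgt (hom_sub Fk sP)) kQ; apply: subset_trans sQ1S.
by apply: fs_ext (fs_comp Ff Fk) => x Px; rewrite hE.
Qed.

Lemma im_level P0 P Q f : F P Q f -> P0 \subset P -> P0 \notin H -> #|P0| = n ->
  im f P0 \notin H /\ #|im f P0| = n.
Proof.
move=> Ff sP0 nH cP0; have Ff0 := hom_sub Ff sP0; split; last by rewrite (card_im Ff0).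
apply: contra nH => Hf; apply: (H_conj Hf); apply: conj_sym; apply/conjP.
by exists f => //; apply: homS Ff0.
Qed.

Lemma level_proper P0 P : P0 \notin H -> P \in H -> P0 \subset P -> P0 \proper P.
Proof. by move=> nH HP; case/eqVproper=> // /group_inj eP; rewrite eP HP in nH. Qed.

Lemma level_norm P0 P Q f : F P Q f -> P0 \proper P -> #|P0| = n ->
  let W := 'N_P(P0)%G in
  [/\ F W S f, P0 \subset W, W \subset 'N(P0) & n < #|W|].
Proof.
move=> Ff ltP0 cP0 W; have sWP : W \subset P := subsetIl _ _.
split; first exact: homS (hom_sub Ff sWP).
- by rewrite subsetI normG (proper_sub ltP0).
- exact: subsetIr.
- by rewrite -cP0; apply: proper_card (proper_normI pS (hom_src Ff) ltP0).
Qed.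

Lemma ltn_norm P : P \subset S -> #|P| = n -> n < #|'N_S(P)|.
Proof.
move=> sPS cP; rewrite -cP; apply: proper_card (proper_normI pS (subxx S) _).
by rewrite properEcard sPS cP.
Qed.

(** For a composite, the two links that leave the middle subgroup are compared on the image of its
    whole normalizer, whose order exceeds [n] because [n < #|S|]. *)
Lemma gen_common P Q f P0 : generated_by F H P Q f -> P0 \subset P -> P0 \notin H ->
  #|P0| = n -> exists R, to_norm F P0 R /\ to_norm F (im f P0) R.
Proof.
move=> gf; elim: gf P0 => {P Q f}
  [P Q P1 Q1 f k HP1 _ Fk sP sQ kQ fk | P Q R f k h gf IHf gk IHk hE] P0 sP0 nH cP0.
  have sP01 := subset_trans sP0 sP.
  have [FW sPW nPW ltW] := level_norm Fk (level_proper nH HP1 sP01) cP0.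
  rewrite (_ : im f P0 = im k P0); first exact: (common_norm pS sat FW sPW nPW ltW).
  by apply: eq_im => x Px; apply: fk; apply: (subsetP sP0).
have Ff := gen_hom gf; have Fk := gen_hom gk.
have sf0 : im f P0 \subset Q by apply: hom_im_sub (hom_sub Ff sP0).
have [nHf cf] := im_level Ff sP0 nH cP0.
have [R1 [n01 n11]] := IHf _ sP0 nH cP0.
have [R2 [n12 n22]] := IHk _ sf0 nHf cf.
have -> : im h P0 = im k (im f P0).
  rewrite -(im_comp _ Ff sP0); apply: eq_im => x Px; apply: hE; exact: (subsetP sP0).
set P1 := im f P0 in n11 n12 n22 sf0 cf *.
have sP1S : P1 \subset S := subset_trans sf0 (hom_src Fk).
have [b1 Fb1 e1] := n11; have [b2 Fb2 e2] := n12.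
have [_ [b1' [Fb1' b1K _]]] := hom_factor Fb1.
have sPN := sub_normS sP1S.
have [||||R0 [nR1]] := common_norm pS sat (Q := im b1 'N_S(P1)) (P := R1) (f := b2 \o b1').
- exact: fs_comp Fb1' Fb2.
- by rewrite -e1; apply: imS Fb1 sPN _.
- by rewrite -e1; apply: im_norm Fb1 sPN (subsetIr _ _).
- by rewrite (card_im Fb1) ltn_norm.
rewrite (im_comp _ Fb1') -?e1; last exact: imS Fb1 sPN _.
rewrite (im_inv Fb1 b1K sPN) e2 => nR2.
have sP0S := subset_trans sP0 (hom_src Ff).
have sP2S : im k P1 \subset S := hom_im_sub (hom_sub (homS Fk) sf0).
exists R0; split; [apply: to_norm_trans n01 nR1 | apply: to_norm_trans n22 nR2] => //.
Qed.

(** A fully normalized [T] works: a link from [T] to a common target maps ['N_S(T)] onto the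
    normalizer there, by comparison of orders, and can be reversed. *)
Lemma exists_top P : P \subset S -> P \notin H -> #|P| = n ->
  exists2 T, fs_conj F P T & top F T.
Proof.
move=> sPS nH cP; have [T cPT nT] := exists_fully_normalized F sPS.
have [_ sTS] := conj_sub cPT.
exists T => // R cTR.
have [f Ff eR] := (conjP F T R).1 cTR.
have nTH : T \notin H by apply: contra nH => HT; apply: H_conj HT (conj_sym cPT).
have [|R' []] := gen_common (H_gen Ff) (subxx T) nTH; first by rewrite -(conj_card cPT).
rewrite eR => nTR nRR; apply: to_norm_trans nRR _; first by case: (conj_sub cTR).
have [b Fb eb] := nTR; have [_ [b' [Fb' bK _]]] := hom_factor Fb.
exists b'; last by rewrite -eb (im_inv Fb bK (sub_normS sTS)).
apply: homS; suff <-: im b 'N_S(T) = 'N_S(R')%G by exact: Fb'.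
apply/eqP; rewrite -val_eqE eqEcard (to_norm_sub sTS Fb eb) (card_im Fb).
exact: nT (to_norm_conj sTS nTR).
Qed.

(** Links [b0] and [b1] into [T] appear so that the claim composes: a restriction of a morphism in
    [H] becomes a link from [T] to itself, to which [link_extends] applies, and in a composite the
    link chosen for the middle subgroup cancels. *)
Lemma gen_extends P Q f P0 T b0 b1 : generated_by F H P Q f -> top F T ->
    P0 \subset P -> P0 \notin H -> #|P0| = n ->
    F 'N_S(P0)%G S b0 -> im b0 P0 = T ->
    F 'N_S(im f P0)%G S b1 -> im b1 (im f P0) = T ->
  exists2 f', F (NOp p F T) S f' & {in P0, forall x, f' (b0 x) = b1 (f x)}.
Proof.
move=> gf topT; elim: gf P0 b0 b1 => {P Q f}
  [P Q P1 Q1 f k HP1 _ Fk sP sQ kQ fk | P Q R f k h gf IHf gk IHk hE]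
  P0 b0 b1 sP0 nH cP0 Fb0 e0 Fb1 e1.
  have sP01 := subset_trans sP0 sP.
  have fk0 : {in P0, f =1 k} by move=> x Px; apply: fk; apply: (subsetP sP0).
  have [FW sPW nPW ltW] := level_norm Fk (level_proper nH HP1 sP01) cP0.
  set W := 'N_P1(P0)%G in FW sPW nPW ltW.
  rewrite (eq_im fk0) in Fb1 e1.
  have sWN : W \subset 'N_S(P0) by rewrite subsetI (hom_src FW) nPW.
  have sPN := subset_trans sPW sWN.
  have Fb0W := hom_sub Fb0 sWN.
  have [_ [c [Fc b0K _]]] := hom_factor Fb0W.
  have FkW : F W 'N_S(im k P0)%G k.
    apply: (hom_tgt FW (subsetIl _ _)) => x Wx.
    by apply: (subsetP (im_normS FW sPW nPW)); rewrite mem_im.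
  have Fl : F (im b0 W) S (b1 \o (k \o c)) := fs_comp (fs_comp Fc FkW) Fb1.
  have [||||f' Ff' f'E] := link_extends pS sat topT Fl.
  - rewrite (im_comp _ (fs_comp Fc FkW)) -?e0; last exact: imS Fb0 sPW sWN.
    rewrite (im_comp _ Fc); last exact: imS Fb0 sPW sWN.
    by rewrite (im_inv Fb0W b0K sPW) e1.
  - by rewrite -e0; apply: imS Fb0 sPW sWN.
  - by rewrite -e0; apply: im_norm Fb0W sPW nPW.
  - by rewrite (card_im Fb0W).
  exists f' => // x Px; rewrite f'E /=; last by rewrite -e0 mem_im.
  by rewrite b0K ?(subsetP sPW) // fk0.
have Ff := gen_hom gf; have Fk := gen_hom gk.
have sf0 : im f P0 \subset Q by apply: hom_im_sub (hom_sub Ff sP0).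
have [nHf cf] := im_level Ff sP0 nH cP0.
have eh : im h P0 = im k (im f P0).
  rewrite -(im_comp _ Ff sP0); apply: eq_im => x Px; apply: hE; exact: (subsetP sP0).
rewrite eh in Fb1 e1; set P1 := im f P0 in Fb1 e1 sf0 nHf cf.
have sP0S := subset_trans sP0 (hom_src Ff).
have sPN := sub_normS sP0S.
have [b Fb eb] : to_norm F P1 T.
  apply: topT; apply: conj_trans (conj_sym _) (_ : fs_conj F P0 _).
    by apply/conjP; exists b0 => //; apply: hom_sub Fb0 sPN.
  by apply/conjP; exists f => //; apply: homS (hom_sub Ff sP0).
have [f1 Ff1 f1E] := IHf _ _ _ sP0 nH cP0 Fb0 e0 Fb eb.
have [f2 Ff2 f2E] := IHk _ _ _ sf0 nHf cf Fb eb Fb1 e1.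
have sTS : T \subset S by rewrite -e0; apply: hom_im_sub (hom_sub Fb0 sPN).
have sTM : T \subset NOp p F T by apply: sub_NOp.
have e1T : im f1 T = T.
  have -> : im f1 T = im (f1 \o b0) P0 by rewrite (im_comp _ Fb0 sPN) e0.
  rewrite -[RHS]eb /P1 -(im_comp _ Ff sP0); apply: eq_im => x Px /=; exact: f1E.
have f1M : im f1 (NOp p F T) \subset NOp p F T.
  by have := im_NOp_sub Ff1 sTM (subxx _); rewrite e1T.
exists (f2 \o f1); first exact: hom_compim Ff1 (hom_sub Ff2 f1M).
by move=> x Px /=; rewrite f1E // f2E ?mem_im // hE ?(subsetP sP0).
Qed.

Lemma aut_extends T a : top F T -> T \subset S -> T \notin H -> #|T| = n ->
    a \in AutFG F T ->
  exists2 f, F (NOp p F T) (NOp p F T) f & {in T, f =1 a}.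
Proof.
move=> topT sTS nH cT Ga; have [Aa Fa] := AutFGP _ _ sTS Ga.
have idT : F 'N_S(T)%G S id by apply: hom_incl (subsetIl _ _) _.
have [|||f Ff fE] := gen_extends (b0 := id) (b1 := id) (H_gen Fa) topT (subxx T) nH cT idT.
- exact: im_id.
- by rewrite (im_perm Aa).
- by rewrite im_id (im_perm Aa).
exists f; last exact: fE.
have eT : im f T = T by rewrite (eq_im (g := a)) ?(im_perm Aa).
apply: (hom_tgt Ff); first exact: subset_trans (NOp_sub _ _ _) (subsetIl _ _).
have := im_NOp_sub Ff (sub_NOp F pS sTS) (subxx _); rewrite eT => sM x Mx.
by apply: (subsetP sM); rewrite mem_im.
Qed.

End Generation.

(** * Saturation on the class of a top subgroup *)

Section FullyNormalizedTop.

Variables (p : nat) (gT : finGroupType) (S : {group gT}) (F : fusion_system S).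
Hypothesis pS : p.-group S.
Implicit Types (P Q R T V W : {group gT}) (f k : gT -> gT) (g : gT).

Variable n : nat.
Hypothesis sat : forall Q, Q \subset S -> n < #|Q| ->
  saturation_I p F Q /\ saturation_II F Q.

Definition extensible T : Prop := forall a, a \in AutFG F T ->
  exists2 f, F (NOp p F T) (NOp p F T) f & {in T, f =1 a}.

Lemma card_NOp_le P R : P \subset S -> to_norm F P R -> #|NOp p F P| <= #|NOp p F R|.
Proof.
move=> sPS [f Ff eR]; have FfN := hom_sub Ff (NOp_sub p F P).
have := im_NOp_sub FfN (sub_NOp F pS sPS) (subxx _).
by rewrite eR => /subset_leq_card; rewrite (card_im FfN).
Qed.

(** Let [R] be the image of [T] in a good pair for [(M, T)]. As ['N_S(T)] normalizes [M], the
    enlarged morphism is defined on all of it, so [R] is a top too. The image of [M] is all of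
    [NOp p F R], because a link from [R] to [T] bounds the order of the latter. *)
Lemma exists_fn_top T : T \subset S -> top F T -> n < #|NOp p F T| -> extensible T ->
  exists R, [/\ fs_conj F T R, top F R, n < #|NOp p F R|, fn_pair p F (NOp p F R) R
              & extensible R].
Proof.
move=> sTS topT ltn extT; set M := NOp p F T in ltn.
have sTM : T \subset M by apply: sub_NOp.
have sMN : M \subset 'N_S(T) := NOp_sub _ _ _.
have sMS : M \subset S := subset_trans sMN (subsetIl _ _).
have [r Fr gr] := exists_fn_pair pS sat sTM sMS ltn.
have ltnr : n < #|im r M| by rewrite (card_im Fr).
have nTM : M \subset 'N(T) := subset_trans sMN (subsetIr _ _).
have [f1 [Ff1 _ eT1]] := fn_pair_norm pS sat gr Fr erefl sTM erefl ltnr nTM.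
set R := im r T in gr eT1.
have FrT := hom_sub Fr sTM.
have sRS : R \subset S := hom_im_sub FrT.
have cTR : fs_conj F T R by apply/conjP; exists r.
have nTR : to_norm F T R.
  exists f1 => //; apply: hom_sub Ff1 _; rewrite subsetI subxx.
  exact: normal_norm (NOp_normal p F sTS).
have eM : im r M = NOp p F R.
  apply/eqP; rewrite -val_eqE eqEcard (im_NOp_sub Fr) // (card_im Fr) card_NOp_le //.
  by apply: topT.
rewrite eM in gr ltnr.
exists R; split=> //.
  move=> V cRV; have [_ sVS] := conj_sub cRV.
  by apply: to_norm_trans nTR => //; apply: topT; apply: conj_trans cRV.
move=> a Ga; have [Aa Fa] := AutFGP _ _ sRS Ga.
have [Fr' [k [Fk rk _]]] := hom_factor Fr; rewrite eM in Fr' Fk.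
have [FrT' _] := hom_factor FrT.
have sRN : R \subset NOp p F R by apply: sub_NOp.
have FkR : F R T k.
  apply: (hom_tgt (hom_sub Fk sRN) sTS) => y.
  rewrite (hom_im FrT) => /imsetP[x Tx ->].
  by rewrite rk // (subsetP sTM).
have [a0 Ga0 a0E] := AutF_ext (fs_comp (fs_comp FrT' Fa) FkR).
have [f Ff fE] := extT a0 Ga0.
(* Conjugating by [r] an extension of the automorphism of [T] that corresponds to [a]. *)
exists (r \o (f \o k)); first exact: fs_comp (fs_comp Fk Ff) Fr'.
move=> y; rewrite {1}(hom_im FrT) => /imsetP[x Tx ->] /=.
rewrite rk ?(subsetP sTM) // fE // a0E //=.
have : a (r x) \in R by rewrite Aut_closed // mem_im.
rewrite {1}(hom_im FrT) => /imsetP[z Tz ->].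
by rewrite rk // (subsetP sTM).
Qed.

Lemma im_cent P W V f : F W S f -> P \subset W -> V \subset W -> V \subset 'C(P) ->
  im f V \subset 'C_S(im f P).
Proof.
move=> Ff sPW sVW cPV; rewrite subsetI (hom_im_sub (hom_sub Ff sVW)).
rewrite (im_sub Ff sPW) (im_sub Ff sVW); apply/centsP=> _ /imsetP[v Vv ->] _ /imsetP[u Pu ->].
have Wv := subsetP sVW v Vv; have Wu := subsetP sPW u Pu.
by rewrite /commute -!(homM Ff) // (centsP cPV v Vv u Pu).
Qed.

Lemma sub_cent_norm P : 'C_S(P) \subset 'N_S(P).
Proof. exact: setIS (cent_sub P). Qed.

Lemma im_cent_norm P R f : P \subset S -> F 'N_S(P)%G S f -> im f P = R ->
  im f 'C_S(P) \subset 'C_S(R).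
Proof.
move=> sPS Ff <-; apply: im_cent Ff (sub_normS sPS) (sub_cent_norm P) _.
exact: subsetIr.
Qed.

Lemma card_cent_le P R : P \subset S -> to_norm F P R -> #|'C_S(P)| <= #|'C_S(R)|.
Proof.
move=> sPS [f Ff eR]; have := subset_leq_card (im_cent_norm sPS Ff eR).
by rewrite (card_im (hom_sub Ff (sub_cent_norm P))).
Qed.

Variable T : {group gT}.
Hypothesis sTS : T \subset S.
Hypothesis topT : top F T.
Hypothesis ltn : n < #|NOp p F T|.
Hypothesis goodT : fn_pair p F (NOp p F T) T.
Hypothesis extT : extensible T.

Let M := NOp p F T.
Let sTM : T \subset M. Proof. exact: sub_NOp. Qed.
Let sMN : M \subset 'N_S(T). Proof. exact: NOp_sub. Qed.
Let sMS : M \subset S. Proof. exact: subset_trans sMN (subsetIl _ _). Qed.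
Let nMN : 'N_S(T) \subset 'N(M). Proof. exact: normal_norm (NOp_normal p F sTS). Qed.

(** Extensibility makes restriction from the stabilizer of [T] in [Aut_F(M)] onto [Aut_F(T)]. The
    image of the Sylow subgroup is then Sylow, and it lies in the [p]-group [Aut_S(T)]. *)
Lemma top_Sylow : p.-Sylow(AutFG F T) (AutS S T).
Proof.
have sD := stab_astabs F M T; have sA := AutS_stab F sMS sTM.
have eG : restr_perm T @* stab F M T = AutFG F T.
  apply/eqP; rewrite eqEsubset (restr_stab_AutFG F sMS sTM) /=.
  apply/subsetP=> a Ga; have [Aa Fa] := AutFGP _ _ sTS Ga.
  have [f Ff fE] := extT Ga; have [c Gc cE] := AutF_ext Ff.
  have ca : {in T, c =1 a} by move=> u Tu; rewrite cE ?fE // (subsetP sTM).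
  have sc : c \in stab F M T.
    by apply/stabP; split=> // u Tu; rewrite ca // Aut_closed.
  suff -> : a = restr_perm T c by rewrite mem_morphim // (subsetP sD).
  have [Ac _] := AutFGP _ _ sMS Gc.
  apply: (eq_Aut Aa (Aut_restr_perm sTM Ac)) => u Tu.
  by rewrite (restr_stabE sc) // ca.
have syl := morphim_pHall (restr_perm_morphism T) (subset_trans sA sD) goodT.2.
rewrite [X in p.-Sylow(X) _]eG in syl.
have sAS : restr_perm T @* AutS 'N_S(T)%G M \subset AutS S T.
  apply/subsetP=> _ /morphimP[b Db Sb ->].
  have sb := subsetP sA b Sb.
  have Rb : restr_perm T b \in restr_perm T @* AutS 'N_S(T)%G M by rewrite mem_morphim.
  have [h [/setIP[Sh _] _ hE]] := restr_AutSP sMS sTM sb Rb.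
  apply/AutS_memP; split.
    apply: (subsetP (AutFG_sub_Aut F sTS)); rewrite -eG mem_morphim //.
  by exists h => // u Tu; rewrite (restr_stabE sb) // hE.
by rewrite (sub_pHall syl (AutS_p _ pS) sAS (AutS_sub_AutFG F sTS)).
Qed.

(** Axiom II for morphisms onto [T]. After a link [b] from [P] to [T], what remains is an
    automorphism of [T]; it extends to [M], and by [fn_pair_ext] its values on [T] extend to
    [im b W <*> M]. *)
Lemma top_ext P f W : F P S f -> im f P = T -> P \subset W -> W \subset 'N_S(P) ->
    {in W, forall g, exists2 h, h \in S & {in P, forall u, f (u ^ g) = f u ^ h}} ->
  exists2 f', F W S f' & {in P, f' =1 f}.
Proof.
move=> Ff eT sPW sWN hW; have sPS := hom_src Ff.
have [b Fb eb] : to_norm F P T.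
  by apply: topT; apply: conj_sym; apply/conjP; exists f.
have FbW := hom_sub Fb sWN; have FbP := hom_sub FbW sPW.
have [Ff' _] := hom_factor Ff; rewrite eT in Ff'.
have [_ [k [Fk bk _]]] := hom_factor FbP; rewrite eb in Fk.
have [a Ga aE] := AutF_ext (fs_comp Fk Ff').
have abE : {in P, forall u, a (b u) = f u}.
  by move=> u Pu; rewrite aE -?eb ?mem_im //= bk.
have [c Fc cE] := extT Ga.
have cbE : {in P, forall u, c (b u) = f u}.
  by move=> u Pu; rewrite cE ?abE // -eb mem_im.
have sbWN : im b W \subset 'N_S(T).
  by rewrite -eb; apply: im_normS FbW sPW (subset_trans sWN (subsetIr _ _)).
have sVN : im b W <*> M \subset 'N_S(T) by rewrite join_subG sbWN.
have cT : im c T = T by rewrite (eq_im cE) (im_perm (AutFGP _ _ sTS Ga).1).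
have cM : im c M = M.
  by apply/eqP; rewrite -val_eqE eqEcard (hom_im_sub Fc) (card_im Fc) leqnn.
have [|g|f' Fe f'E] := fn_pair_ext pS sat goodT (homS Fc) cM sTM cT ltn
    (_ : im b W <*> M \subset _)%G (joing_subr _ _).
- by rewrite subsetI (subset_trans sVN) ?subsetIl // (subset_trans sVN).
- rewrite /= norm_joinEl ?(subset_trans sbWN) // => /mulsgP[y m].
  rewrite {1}(hom_im FbW) => /imsetP[w Ww ->] Mm ->.
  have [h Sh hE] := hW w Ww.
  have nPw : w \in 'N(P) by case/setIP: (subsetP sWN w Ww).
  have Nh : h \in 'N_S(T).
    rewrite inE Sh -eT; apply/normP/eqP; rewrite eqEcard cardJg leqnn andbT.
    rewrite {1}(hom_im Ff); apply/subsetP=> _ /imsetP[_ /imsetP[u Pu ->] ->].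
    by rewrite -hE // mem_im // memJ_norm.
  have Mcm : c m \in M by rewrite -cM mem_im.
  have Ncm := subsetP sMN _ Mcm.
  (* Under [c], conjugation of [T] by [b w] becomes conjugation by the [h] given for [w], and that
     by [m] becomes conjugation by [c m]. *)
  exists (h * c m); split; first exact: groupM.
    by rewrite groupM ?(subsetP nMN).
  move=> v; rewrite -{1}eb {1}(hom_im FbP) => /imsetP[u Pu ->].
  have Pw : u ^ w \in P by rewrite memJ_norm.
  rewrite !conjgM -(homJ FbW) ?(subsetP sPW u) // (homJ Fc) //.
    by rewrite !cbE // hE.
  by apply: (subsetP sTM); rewrite -eb mem_im.
have sbV : im b W \subset (im b W <*> M)%G := joing_subl _ _.
exists (f' \o b); first exact: hom_compim FbW (hom_sub Fe sbV).
by move=> u Pu /=; rewrite f'E ?cbE // -eb mem_im.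
Qed.

(** Following [f] by a link [b] to [T] yields an extension [d] on [Nphi], which must be brought back
    along [b]. There [d g] and [b h] act alike on [T], so they differ by an element of ['C_S(T)];
    this group is the image of ['C_S(Q)] because [Q] is fully centralized. *)
Lemma top_saturation_II P : fs_conj F T P -> saturation_II F P.
Proof.
move=> cTP f Ff; set Q := (f @* P)%G => cQ.
have eQ : im f P = Q.
  by apply: group_inj; rewrite (hom_im Ff) /Q /= morphimEdom.
have [_ sPS] := conj_sub cTP.
have sQS : Q \subset S by rewrite -eQ; apply: hom_im_sub Ff.
have cTQ : fs_conj F T Q.
  by apply: conj_trans cTP _; apply/conjP; exists f.
have nQT := topT cTQ; have [b Fb eb] := nQT.
have sQN := sub_normS sQS; have FbQ := hom_sub Fb sQN.
have Fbf : F P S (b \o f) by apply: hom_compim Ff _; rewrite eQ.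
have ebf : im (b \o f) P = T by rewrite (im_comp _ Ff (subxx _)) eQ.
set W := Nphi_group S f.
have sWN : W \subset 'N_S(P) by apply/subsetP=> g; rewrite inE => /andP[].
have hE g : g \in W -> exists2 h, h \in 'N_S(Q) & {in P, forall u, f (u ^ g) = f u ^ h}.
  rewrite -groupV inE => /andP[_ /exists_inP[a]].
  rewrite AutSE => /morphimP[h Nh Sh ->] /forall_inP aE.
  exists h => // u Pu; have Qfu : f u \in Q by rewrite -eQ mem_im.
  by have := eqP (aE u Pu); rewrite (norm_conj_autE Nh Qfu) /cmap invgK => ->.
have sPW : P \subset W.
  apply/subsetP=> u Pu; rewrite inE (subsetP (sub_normS sPS)) //=.
  have Qfu : f u^-1 \in Q by rewrite -eQ mem_im ?groupV.
  apply/exists_inP; exists (conj_aut Q (f u^-1)).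
    by rewrite AutSE mem_morphim ?(subsetP (normG _)) // (subsetP sQN).
  apply/forall_inP=> v Pv; rewrite norm_conj_autE ?(subsetP (normG _) _ Qfu) //.
    by rewrite /cmap -(homJ Ff) ?groupV.
  by rewrite -eQ mem_im.
have [|d Fd dE] := top_ext Fbf ebf sPW sWN.
  move=> g Wg; have [h Nh fhE] := hE g Wg.
  exists (b h) => [|u Pu /=]; first exact: hom_mem Fb Nh.
  by rewrite fhE // (homJ Fb) // (subsetP sQN) // -eQ mem_im.
have eC : im b 'C_S(Q) = 'C_S(T)%G.
  apply/eqP; rewrite -val_eqE eqEcard (im_cent_norm sQS Fb eb).
  by rewrite (card_im (hom_sub Fb (sub_cent_norm Q))); apply/cQ/conj_sym.
have [_ [k [Fk bk kb]]] := hom_factor Fb.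
have sdN : im d W \subset im b 'N_S(Q).
  rewrite (hom_im Fd); apply/subsetP=> _ /imsetP[g Wg ->].
  have [h Nh fhE] := hE g Wg.
  have Nbh : b h \in im b 'N_S(Q) by rewrite mem_im.
  rewrite -(groupMr _ (groupVr Nbh)).
  have sCN : 'C_S(T)%G \subset im b 'N_S(Q) by rewrite -eC; apply: imS Fb (sub_cent_norm Q) _.
  apply: (subsetP sCN); rewrite inE groupM ?groupV ?(hom_mem Fd Wg) ?(hom_mem Fb Nh) //=.
  apply/centP=> y; rewrite -ebf {1}(hom_im Fbf) => /imsetP[u Pu ->].
  apply/commute_sym/commgP/conjg_fixP.
  have nPg : g \in 'N(P) by case/setIP: (subsetP sWN g Wg).
  have Pug : u ^ g \in P by rewrite memJ_norm.
  have Qfu : f u \in Q by rewrite -eQ mem_im.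
  have du : d u = b (f u) := dE u Pu.
  have e : d u ^ d g = b (f u) ^ b h.
    rewrite -(homJ Fd) ?(subsetP sPW u) // dE //= fhE //.
    by rewrite (homJ Fb) // (subsetP sQN).
  by rewrite /= conjgM -{1}du e conjgK.
have FkN : F (im b 'N_S(Q)) S k := homS Fk.
have Fkd : F W S (k \o d) := hom_compim Fd (hom_sub FkN sdN).
exists (Morphism (homM Fkd)); split=> // u Pu /=.
by rewrite dE //= bk // (subsetP sQN) // -eQ mem_im.
Qed.

(** For a fully normalized [P], the link to [T] maps ['N_S(P)] onto ['N_S(T)]. Its inverse is a link
    from [T] to [P], along which centralizer orders do not drop and [Aut_S(T)] is carried into
    [Aut_S(P)]. *)
Lemma top_saturation_I P : fs_conj F T P -> saturation_I p F P.
Proof.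
move=> cTP nP; have [_ sPS] := conj_sub cTP; have cPT := conj_sym cTP.
have nPT := topT cTP; have [b Fb eb] := nPT; have sPN := sub_normS sPS.
have [_ [k [Fk bk _]]] := hom_factor Fb.
have eN : im b 'N_S(P) = 'N_S(T)%G.
  by apply/eqP; rewrite -val_eqE eqEcard (to_norm_sub sPS Fb eb) (card_im Fb) nP.
rewrite eN in Fk; have FkS := homS Fk.
have ek : im k T = P by rewrite -eb (im_inv Fb bk sPN).
have nTP : to_norm F T P by exists k.
split=> [R cPR|].
  have [_ sRS] := conj_sub cPR.
  apply: leq_trans (card_cent_le sRS (topT _)) (card_cent_le sTS nTP).
  exact: conj_trans cTP cPR.
have FkT := hom_sub FkS (sub_normS sTS).
have [t [tI _ tG tE]] := transport FkT; rewrite ek in tG.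
have sA := AutFG_sub_Aut F sTS.
have syl := morphim_pHall t (subset_trans (AutS_sub_AutFG F sTS) sA) top_Sylow.
rewrite [X in p.-Sylow(X) _]tG in syl.
rewrite -AutFGE // (sub_pHall syl (AutS_p _ pS) _ (AutS_sub_AutFG F sPS)) //.
apply/subsetP=> _ /morphimP[a Aa Sa ->].
have [_ [h Sh hE]] := AutS_memP _ _ _ Sa.
have Gta : t a \in AutFG F P.
  by rewrite -tG mem_morphim // (subsetP (AutS_sub_AutFG F sTS)).
have [Ata _] := AutFGP _ _ sPS Gta.
have Nh : h \in 'N_S(T).
  rewrite inE Sh; apply/normP/eqP; rewrite eqEcard cardJg leqnn andbT.
  by apply/subsetP=> _ /imsetP[u Tu ->]; rewrite -hE // Aut_closed.
apply/AutS_memP; split=> //; exists (k h); first exact: hom_mem FkS Nh.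
move=> y; rewrite -{1}ek {1}(hom_im FkT) => /imsetP[u Tu ->].
by rewrite tE // hE // (homJ FkS) // (subsetP (sub_normS sTS)).
Qed.

End FullyNormalizedTop.

(** * Conditions for [NOp] to be larger than [P] *)

Section ProperNOp.

Variables (p : nat) (gT : finGroupType) (S : {group gT}) (F : fusion_system S).
Hypothesis pS : p.-group S.
Implicit Types P Q : {group gT}.

Lemma proper_NOp_cent P : P \subset S -> 'C_S(P) <> 'Z(P) -> P \proper NOp p F P.
Proof.
move=> sPS neC; have [eM|//] := eqVproper (sub_NOp F pS sPS).
case: neC; apply/eqP; rewrite eqEsubset; apply/andP; split; last exact: setSI.
by rewrite subsetI subsetIr andbT {2}eM cent_sub_NOp.
Qed.

(** As [Inn P] is a [p]-group, [O_p(Out_F(P))] is [O_p(Aut_F(P))] modulo [Inn P]. A class shared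
    with [Out_S(P)] thus comes from conjugation by an element of [NOp], and is trivial if that group
    is [P]. *)
Lemma proper_NOp_Out P : P \subset S -> OutS S P :&: 'O_p(OutF F P) != 1 ->
  P \proper NOp p F P.
Proof.
move=> sPS; have [eM|//] := eqVproper (sub_NOp F pS sPS); case/negP.
have sIB := Inn_sub_OpAut F pS sPS.
have nIG : Inn P <| AutFG F P := Inn_normal F sPS.
have pI : p.-group (Inn P) by rewrite morphim_pgroup // (pgroupS sPS).
rewrite /OutS /OutF -AutFGE // pquotient_pcore // -subG1.
apply/subsetP=> _ /setIP[/morphimP[a Na Sa ->] Ba].
have Ba' : a \in OpAut p F P.
  have nIB : Inn P <| OpAut p F P := normalS sIB (pcore_sub _ _) nIG.
  by rewrite -(quotientGK nIB) mem_morphpre.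
move: Sa Ba'; rewrite /= AutSE => /morphimP[g nPg /setIP[Sg _] ->] Bg.
have Pg : g \in P by rewrite eM; apply/NOpP.
by rewrite inE; apply/eqP/coset_id; apply: mem_morphim.
Qed.

End ProperNOp.

(** * The descending induction on the order *)

Theorem theorem2p2 (p : nat) (p_pr : prime p)
  (gT : finGroupType) (S : {group gT}) (pS : p.-group S)
  (F : fusion_system S) (H : {set {group gT}})
  (H_sub : forall P : {group gT}, P \in H -> P \subset S)
  (H_conj : conj_closed F H)
  (H_cr : forall P : {group gT}, P \subset S ->
     centric F P -> radical p F P -> P \in H)
  (H_gen : H_generated F H)
  (H_sat : H_saturated p F H)
  (H_out : forall P : {group gT}, P \subset S -> centric F P -> P \notin H ->
     exists P' : {group gT}, fs_conj F P P' /\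
       OutS S P' :&: 'O_p(OutF F P') != 1) :
  saturated p F.
Proof.
move=> P; have [m] := ubnP (#|S| - #|P|); elim: m P => // m IHm P lem sPS.
have [|nH] := boolP (P \in H); first exact: H_sat.
set n := #|P| in lem.
have sat (Q : {group gT}) : Q \subset S -> n < #|Q| -> saturation_I p F Q /\ saturation_II F Q.
  move=> sQS ltn; apply: IHm => //; rewrite -ltnS (leq_trans _ lem) // ltnS.
  by rewrite ltn_sub2l // (leq_trans ltn) // subset_leq_card.
have [P' cPP' ltP'] : exists2 P', fs_conj F P P' & P' \proper NOp p F P'.
  have [cP|ncP] := classic (centric F P).
    have [P' [cPP' neO]] := H_out P sPS cP nH; exists P' => //.
    by apply: proper_NOp_Out neO; case: (conj_sub cPP').
  have [P' ncP'] := not_all_ex_not _ _ ncP.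
  have [cPP' neC] := imply_to_and _ _ ncP'; exists P' => //.
  by apply: proper_NOp_cent neC; case: (conj_sub cPP').
have [_ sP'S] := conj_sub cPP'.
have ltnP' : n < #|NOp p F P'| by rewrite /n (conj_card cPP') proper_card.
have lt_nS : n < #|S|.
  by rewrite (leq_trans ltnP') // subset_leq_card // (subset_trans (NOp_sub _ _ _)) // subsetIl.
have [T cPT topT] := exists_top pS H_conj H_gen sat lt_nS sPS nH erefl.
have [_ sTS] := conj_sub cPT.
(* Links do not shrink [NOp], so the strict inequality passes from [P'] to [T]. *)
have ltnT : n < #|NOp p F T|.
  apply: leq_trans ltnP' (card_NOp_le pS sP'S (topT _ _)).
  exact: conj_trans (conj_sym cPT) cPP'.
have nTH : T \notin H by apply: contra nH => HT; apply: H_conj HT (conj_sym cPT).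
have extT : extensible p F T.
  by move=> a; apply: (aut_extends pS H_conj H_gen sat topT sTS nTH); rewrite -(conj_card cPT).
have [R [cTR topR ltnR goodR extR]] := exists_fn_top pS sat sTS topT ltnT extT.
have [_ sRS] := conj_sub cTR.
have cRP : fs_conj F R P by apply: conj_sym; apply: conj_trans cTR.
split; first exact: (top_saturation_I pS sRS topR goodR extR).
exact: (top_saturation_II pS sat sRS topR ltnR goodR extR).
Qed.
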